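(* Let $n\in\mathbb N$ and let $T:\mathbb C_n[z]\to\mathbb C[z]$ be a linear operator. Then $T$ maps $\pi_n(\mathbb R)$ into $\pi(\mathbb R)\cup\{0\}$ if and only if one of the following holds: (a) $T$ has range of dimension at most one and $T(f)=\alpha(f)P$ for $f\in\mathbb C_n[z]$, where $\alpha:\mathbb C_n[z]\to\mathbb C$ is a linear functional and $P\in\mathcal H_1(\mathbb R)$; (b) $T$ has range of dimension at most two and $T(f)=\eta\alpha(f)P+\eta\beta(f)Q$ for $f\in\mathbb C_n[z]$, where $\eta\in\mathbb C$, $\alpha,\beta:\mathbb C_n[z]\to\mathbb C$ are linear functionals with $\alpha(\mathbb R_n[z])\subseteq\mathbb R$, $\beta(\mathbb R_n[z])\subseteq\mathbb R$, and $P,Q\in\mathcal H_1(\mathbb R)$ have interlacing zeros; (c) there is $\eta\in\mathbb C$ with $\eta\,T[(z+w)^n]\in\mathcal H_2(\mathbb R)$; (d) there is $\eta\in\mathbb C$ with $\eta\,T[(z-w)^n]\in\mathcal H_2(\mathbb R)$.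
   Context: For $\Omega\subseteq\mathbb C$, $\pi(\Omega)$ is the set of non-zero univariate complex polynomials all of whose zeros lie in $\Omega$ (non-zero constants included) and $\pi_n(\Omega)$ is the subset of those of degree at most $n$. $\mathbb C_n[z]$ ($\mathbb R_n[z]$) denotes complex (real) polynomials of degree at most $n$. A polynomial $f\in\mathbb C[z_1,\dots,z_k]$ is stable if it is non-zero and $f(z_1,\dots,z_k)\neq0$ whenever $\Im z_j>0$ for all $j$; real stable if moreover its coefficients are real. $\mathcal H_k(\mathbb C)$, $\mathcal H_k(\mathbb R)$ denote the stable, resp. real stable, polynomials in $k$ variables; so $\mathcal H_1(\mathbb R)$ is the set of non-zero real polynomials with only real zeros. The zeros $\alpha_1\le\dots\le\alpha_p$ and $\beta_1\le\dots\le\beta_q$ of two such polynomials interlace if either $\alpha_1\le\beta_1\le\alpha_2\le\beta_2\le\cdots$ or $\beta_1\le\alpha_1\le\beta_2\le\alpha_2\le\cdots$; the zeros of any two polynomials of degree $0$ or $1$ interlace by convention. $T$ is extended to polynomials in $z,w$ by $T(z^kw^\ell)=T(z^k)w^\ell$. *)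

(* Defs.v *)
From HB Require Import structures.
From mathcomp Require Import all_boot all_order all_algebra.
From mathcomp Require Import reals.
From mathcomp Require Import complex.
Set Implicit Arguments. Unset Strict Implicit. Unset Printing Implicit Defensive.
Import Order.TTheory GRing.Theory Num.Theory.
Local Open Scope ring_scope.
Local Open Scope complex_scope.

(* Real world: R : realType (a complete archimedean ordered field, i.e. the
   reals); complex numbers are R[i]. Univariate polynomials in z are
   {poly R[i]}; bivariate polynomials in z,w are {poly {poly R[i]}}, where the
   OUTER variable is w and the inner variable (the coefficients) is z. *)

Section Defs.
Variable R : realType.
Local Notation C := R[i].

Definition polyle (n : nat) (f : {poly C}) : Prop := (size f <= n.+1)%N.

Definition realpoly (f : {poly C}) : Prop := forall j, Im f`_j = 0.

Definition linear_on (V : lmodType C) (n : nat) (L : {poly C} -> V) : Prop :=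
  forall (a : C) (f g : {poly C}), polyle n f -> polyle n g ->
    L (a *: f + g) = a *: L f + L g.

Definition realrooted (f : {poly C}) : Prop := forall z, root f z -> Im z = 0.

Definition piR (f : {poly C}) : Prop := f != 0 /\ realrooted f.

Definition H1R (f : {poly C}) : Prop := [/\ f != 0, realpoly f & realrooted f].

Definition zeroseq (P : {poly C}) (s : seq R) : Prop :=
  sorted <=%R s /\ P = lead_coef P *: \prod_(x <- s) ('X - (x%:C)%:P).

Definition interl (a b : seq R) : Prop :=
  [/\ (size b <= size a <= (size b).+1)%N,
      (forall i, (i < size b)%N -> a`_i <= b`_i) &
      (forall i, (i.+1 < size a)%N -> (i < size b)%N -> b`_i <= a`_(i.+1))].

Definition interlacing (P Q : {poly C}) : Prop :=
  exists a b, [/\ zeroseq P a, zeroseq Q b & interl a b \/ interl b a].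

Definition H2R (F : {poly {poly C}}) : Prop :=
  [/\ F != 0, (forall i j, Im (F`_i)`_j = 0) &
      forall z w : C, 0 < Im z -> 0 < Im w -> (F.[w%:P]).[z] != 0].

(* T extended to bivariate polynomials: T(z^k w^l) = T(z^k) w^l *)
Definition Text (T : {poly C} -> {poly C}) (F : {poly {poly C}}) :
  {poly {poly C}} := map_poly T F.

Definition zpw (n : nat) : {poly {poly C}} := ('X%:P + 'X) ^+ n.
Definition zmw (n : nat) : {poly {poly C}} := ('X%:P - 'X) ^+ n.

End Defs.

(* Main.v *)
Require Import Defs.
From HB Require Import structures.
From mathcomp Require Import all_boot all_order all_algebra.
From mathcomp Require Import reals.
From mathcomp Require Import complex polyrcf ring lra zify.
From mathcomp Require boolp.
Import Order.TTheory GRing.Theory Num.Theory.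
Local Open Scope ring_scope.
Local Open Scope complex_scope.

Set Implicit Arguments. Unset Strict Implicit. Unset Printing Implicit Defensive.

(** Sufficiency.  If [T((z+w)^n)] is stable then, by Grace's theorem applied to
the functional [f |-> T(f)(z)], [T(f)(z) <> 0] for [Im z > 0] and [f] of degree
[n] with all its zeros in the open lower half-plane; real-rooted [f] are limits
of such polynomials and Hurwitz's theorem concludes.  For interlacing [P] and
[Q], the argument of [P/Q] is an alternating sum of increasing angles, so
[Im (P/Q)] has a constant sign on the upper half-plane.

Necessity.  A real polynomial of degree at least [n-1] with simple real zeros
stays real-rooted under small perturbations of degree at most [n].  Perturbing
shows that the real and imaginary parts of [T(f)] are proportional for every
real [f], so that either the range is a line or [T] is real up to a constant.
For real [T] put [F(z,w) = T((z+w)^n)].  If [|F(z,w)| = |F(z,w')|] with [w']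
conjugate to [w] and [z], [w] in the upper half-plane, then [z] is a zero of
[T(r)] for a real combination [r] of [(x+w)^n] and [(x+w')^n]; such an [r] has
simple real zeros, hence [T(r) = 0], every real polynomial in the range is
real-rooted or zero, evaluation at [i] embeds the real range in the plane, and
the range is spanned by at most two interlacing polynomials.  Otherwise
[|F(z,w)|^2 - |F(z,w')|^2] keeps a constant sign, which gives (c) or (d). *)

(** * Coordinates of complex numbers *)

Section ComplexCoordinates.
Variable R : realType.
Local Notation Re := (@complex.Re R).
Local Notation Im := (@complex.Im R).
Local Notation C := R[i].
Implicit Types (x y z w : C) (f g : {poly C}) (p q : {poly R}).

(** Squared modulus with values in [R]: estimates become polynomial inequalities in the coordinates,
    without square roots. *)
Definition sqmod z : R := Re z ^+ 2 + Im z ^+ 2.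
Definition rpoly p : {poly C} := map_poly (real_complex R) p.
Definition repoly f : {poly R} := map_poly Re f.
Definition impoly f : {poly R} := map_poly Im f.

Lemma ReD x y : Re (x + y) = Re x + Re y. Proof. by case: x; case: y. Qed.
Lemma ImD x y : Im (x + y) = Im x + Im y. Proof. by case: x; case: y. Qed.
Lemma ReN x : Re (- x) = - Re x. Proof. by case: x. Qed.
Lemma ImN x : Im (- x) = - Im x. Proof. by case: x. Qed.
Lemma ReMn x n : Re (x *+ n) = Re x *+ n.
Proof. by elim: n => // n IHn; rewrite !mulrS ReD IHn. Qed.
Lemma ImMn x n : Im (x *+ n) = Im x *+ n.
Proof. by elim: n => // n IHn; rewrite !mulrS ImD IHn. Qed.
Lemma ReM x y : Re (x * y) = Re x * Re y - Im x * Im y.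
Proof. by case: x; case: y. Qed.
Lemma ImM x y : Im (x * y) = Re x * Im y + Im x * Re y.
Proof. by case: x; case: y => a b c d /=. Qed.
Lemma ReJ x : Re (conjc x) = Re x. Proof. by case: x. Qed.
Lemma ImJ x : Im (conjc x) = - Im x. Proof. by case: x. Qed.
Lemma Re_real (a : R) : Re a%:C = a. Proof. by []. Qed.
Lemma Im_real (a : R) : Im a%:C = 0. Proof. by []. Qed.
Lemma Re_i : Re ('i%C : C) = 0. Proof. by []. Qed.
Lemma Im_i : Im ('i%C : C) = 1. Proof. by []. Qed.

End ComplexCoordinates.

Ltac coord := rewrite /sqmod; repeat (first
  [rewrite ReD | rewrite ImD | rewrite ReN | rewrite ImN | rewrite ReM
  | rewrite ImM | rewrite ReJ | rewrite ImJ | rewrite Re_i | rewrite Im_i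
  | rewrite Re_real | rewrite Im_real]).

(** * Complex polynomials, their real and imaginary parts *)

Section ComplexPolynomials.
Variable R : realType.
Local Notation C := R[i].
Local Notation Re := (@complex.Re R).
Local Notation Im := (@complex.Im R).
Implicit Types (x y z w : C) (f g : {poly C}) (p q : {poly R}).

Lemma complex_eqP x y : Re x = Re y -> Im x = Im y -> x = y.
Proof. by case: x y => [a b] [c d] /= -> ->. Qed.

Lemma realE z : Im z = 0 -> z = (Re z)%:C.
Proof. by case: z => a b /= ->. Qed.

Lemma sqmodM x y : sqmod (x * y) = sqmod x * sqmod y.
Proof. coord; ring. Qed.
Lemma sqmod_ge0 x : 0 <= sqmod x.
Proof. by rewrite addr_ge0 ?sqr_ge0. Qed.
Lemma sqmod_eq0 x : (sqmod x == 0) = (x == 0).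
Proof. by rewrite paddr_eq0 ?sqr_ge0 // !sqrf_eq0 eq_complex. Qed.
Lemma sqmod_gt0 x : (0 < sqmod x) = (x != 0).
Proof. by rewrite lt_def sqmod_ge0 sqmod_eq0 andbT. Qed.
Lemma sqmod0 : sqmod (0 : C) = 0. Proof. by apply/eqP; rewrite sqmod_eq0. Qed.
Lemma sqmodJ x : sqmod (conjc x) = sqmod x.
Proof. by coord; rewrite sqrrN. Qed.
Lemma mulcJ x : x * conjc x = (sqmod x)%:C.
Proof. apply: complex_eqP; coord; ring. Qed.
Lemma Im_inv x : Im x^-1 = - Im x / sqmod x.
Proof. by case: x => a b /=; rewrite /sqmod /= mulNr. Qed.
Lemma sqmodX x n : sqmod (x ^+ n) = sqmod x ^+ n.
Proof.
elim: n => [|n IHn]; first by rewrite !expr0 /sqmod /= expr1n expr0n addr0.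
by rewrite !exprS sqmodM IHn.
Qed.

Lemma coef_rpoly p j : (rpoly p)`_j = (p`_j)%:C.
Proof. by rewrite coef_map. Qed.
Lemma coef_repoly f j : (repoly f)`_j = Re f`_j.
Proof. by rewrite coef_map_id0. Qed.
Lemma coef_impoly f j : (impoly f)`_j = Im f`_j.
Proof. by rewrite coef_map_id0. Qed.

Lemma poly_ReIm f : f = rpoly (repoly f) + 'i%C *: rpoly (impoly f).
Proof.
apply/polyP => j; rewrite coefD coefZ !coef_rpoly coef_repoly coef_impoly.
by apply: complex_eqP; coord; ring.
Qed.

(** The definitions use the imaginary part with values in [C], the proof uses the coordinate with
    values in [R]; this lemma and the next three translate. *)
Lemma NumIm_eq0 z : Num.Theory.Im z = 0 <-> Im z = 0.
Proof.
by rewrite -complexIm; split=> [/(congr1 Re)|->].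
Qed.
Lemma NumIm_gt0 z : (0 < Num.Theory.Im z) = (0 < Im z).
Proof. by rewrite -complexIm ltcR. Qed.
Lemma realpolyP f : realpoly f <-> (forall j, Im f`_j = 0).
Proof. by split=> fR j; apply/NumIm_eq0. Qed.
Lemma realrootedP f : realrooted f <-> (forall z, root f z -> Im z = 0).
Proof. by split=> fR z /fR /NumIm_eq0. Qed.

Lemma realpoly_rpoly p : realpoly (rpoly p).
Proof. by apply/realpolyP => j; rewrite coef_rpoly. Qed.

Lemma realpolyE f : realpoly f -> f = rpoly (repoly f).
Proof.
by move=> /realpolyP fR; apply/polyP => j; rewrite coef_rpoly coef_repoly -realE.
Qed.

Lemma rpolyK p : repoly (rpoly p) = p.
Proof. by apply/polyP => j; rewrite coef_repoly coef_rpoly. Qed.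
Lemma rpoly_inj : injective (@rpoly R). Proof. exact: can_inj rpolyK. Qed.
Lemma rpoly_eq0 p : (rpoly p == 0) = (p == 0).
Proof. by rewrite map_poly_eq0. Qed.
Lemma rpolyD p q : rpoly (p + q) = rpoly p + rpoly q.
Proof. exact: rmorphD. Qed.
Lemma rpolyM p q : rpoly (p * q) = rpoly p * rpoly q.
Proof. exact: rmorphM. Qed.
Lemma rpolyZ (a : R) p : rpoly (a *: p) = a%:C *: rpoly p.
Proof. exact: map_polyZ. Qed.
Lemma size_rpoly p : size (rpoly p) = size p.
Proof. by rewrite size_map_poly. Qed.
Lemma rpoly_prod (s : seq R) :
  rpoly (\prod_(x <- s) ('X - x%:P)) = \prod_(x <- s) ('X - (x%:C)%:P).
Proof.
rewrite /rpoly rmorph_prod; apply: eq_bigr => x _.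
by rewrite rmorphB /= map_polyX map_polyC.
Qed.
Lemma size_repoly f : (size (repoly f) <= size f)%N.
Proof. exact: size_poly. Qed.
Lemma size_impoly f : (size (impoly f) <= size f)%N.
Proof. exact: size_poly. Qed.

Lemma horner_rpoly p (x : R) : (rpoly p).[x%:C] = (p.[x])%:C.
Proof. by rewrite horner_map. Qed.
Lemma horner_rpolyJ p z : (rpoly p).[conjc z] = conjc (rpoly p).[z].
Proof.
rewrite -horner_map; congr _.[_]; apply/polyP => j.
by rewrite [RHS]coef_map !coef_rpoly; apply: complex_eqP; coord; rewrite ?oppr0.
Qed.
Lemma Re_horner f (x : R) : Re f.[x%:C] = (repoly f).[x].
Proof.
by rewrite {1}[f]poly_ReIm hornerD hornerZ !horner_rpoly; coord; ring.
Qed.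
Lemma Im_horner f (x : R) : Im f.[x%:C] = (impoly f).[x].
Proof.
by rewrite {1}[f]poly_ReIm hornerD hornerZ !horner_rpoly; coord; ring.
Qed.

Lemma root_scale_prod (c : C) (s : seq C) z : c != 0 ->
  root (c *: \prod_(x <- s) ('X - x%:P)) z = (z \in s).
Proof. by move=> c0; rewrite rootZ // root_prod_XsubC. Qed.

Lemma horner_prod_XsubC (s : seq C) z :
  (\prod_(x <- s) ('X - x%:P)).[z] = \prod_(x <- s) (z - x).
Proof. by rewrite horner_prod; apply: eq_bigr => x _; rewrite !hornerE. Qed.

Lemma sqmod_prod (I : Type) (s : seq I) (F : I -> C) :
  sqmod (\prod_(x <- s) F x) = \prod_(x <- s) sqmod (F x).
Proof.
elim: s => [|x s IHs]; last by rewrite !big_cons sqmodM IHs.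
by rewrite !big_nil /sqmod /= expr1n expr0n addr0.
Qed.

(** The linear factors have real zeros, so only the leading coefficient can fail to be real. This
    reduces complex inputs to real ones. *)
Lemma realrooted_factor f : f != 0 -> realrooted f ->
  exists s : seq R, f = lead_coef f *: rpoly (\prod_(x <- s) ('X - x%:P)).
Proof.
move=> f0 fR; have [s Es] := closed_field_poly_normal f.
exists (map (Re) s); rewrite rpoly_prod big_map {1}Es.
congr (_ *: _); apply: eq_big_seq => x xs; rewrite -realE //.
by apply: (realrootedP f).1 => //; rewrite Es root_scale_prod ?lead_coef_eq0.
Qed.

End ComplexPolynomials.

(** * Laguerre, Harnack, Hurwitz *)

Section Stability.
Variable R : realType.
Local Notation C := R[i].
Local Notation Re := (@complex.Re R).
Local Notation Im := (@complex.Im R).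
Implicit Types (x y z w : C) (f g : {poly C}) (p q : {poly R}).

Lemma poly_factor f : f != 0 -> exists s : seq C,
  [/\ f = lead_coef f *: \prod_(x <- s) ('X - x%:P), size f = (size s).+1
    & forall z, root f z = (z \in s)].
Proof.
move=> f0; have [s Es] := closed_field_poly_normal f; exists s; split=> //.
  by rewrite Es size_scale ?lead_coef_eq0 // size_prod_XsubC.
by move=> z; rewrite Es root_scale_prod ?lead_coef_eq0.
Qed.

Lemma sqmodV x : sqmod x^-1 = (sqmod x)^-1.
Proof.
have [->|x0] := eqVneq x 0; first by rewrite invr0 sqmod0 invr0.
have s0 : sqmod x != 0 by rewrite sqmod_eq0.
apply: (mulfI s0); rewrite -sqmodM !mulfV // /sqmod /=.
by rewrite expr1n expr0n addr0.
Qed.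

Lemma deriv_prod_XsubC (s : seq C) w : w \notin s ->
  (\prod_(x <- s) ('X - x%:P))^`().[w]
  = (\prod_(x <- s) ('X - x%:P)).[w] * \sum_(x <- s) (w - x)^-1.
Proof.
elim: s => [|x s IHs]; first by rewrite !big_nil derivC horner0 mulr0.
rewrite inE negb_or => /andP[wx /IHs IH].
rewrite !big_cons derivM derivXsubC !hornerE IH.
by rewrite mulrDr mulrAC mulfV ?subr_eq0 // mul1r mulrA.
Qed.

(* The points [1/(w - r)] with [Im r <= 0] lie in the disk
   [Im w * |u|^2 + Im u <= 0]; the inequality for the sum follows from
   [2 Re (u * conj v) - |v|^2 <= |u|^2], which is linear in [u]. *)
Lemma sum_inv_disk (s : seq C) w v : 0 < Im w -> {in s, forall r, Im r <= 0} ->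
  Im w * (2 * Re ((\sum_(r <- s) (w - r)^-1) * conjc v)
          - (size s)%:R * sqmod v) + Im (\sum_(r <- s) (w - r)^-1) <= 0.
Proof.
move=> w0; elim: s => [|r s IHs] rs.
  by rewrite big_nil mul0r /= mulr0 mul0r subr0 mulr0 addr0.
have {}IHs := IHs (fun x xs => rs x (mem_behead (s := r :: s) xs)).
have r0 := rs r (mem_head _ _).
rewrite big_cons [size _]/= -[(size s).+1]addn1 natrD; set S := \sum_(_ <- _) _ in IHs *.
set u := (w - r)^-1.
have t0 : 0 < sqmod (w - r).
  rewrite sqmod_gt0 subr_eq0; apply: contraTneq w0 => ->.
  by rewrite -leNgt.
have Hu : Im w * sqmod u + Im u <= 0.
  rewrite /u sqmodV Im_inv -mulrDl pmulr_lle0 ?invr_gt0 //.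
  by coord; lra.
have Hv : 0 <= sqmod (u - v) by apply: sqmod_ge0.
have E : sqmod (u - v) = sqmod u - 2 * Re (u * conjc v) + sqmod v.
  by coord; ring.
move: Hv; rewrite E !mulrDl ReD ImD mul1r => Hv.
have := mulr_ge0 (ltW w0) Hv; lra.
Qed.

(* Laguerre's theorem for the closed lower half-plane. *)
Lemma polar_derivative_neq0 (N : nat) f xi w :
  (0 < N)%N -> (size f <= N.+1)%N -> (forall z, 0 < Im z -> f.[z] != 0) ->
  0 < Im xi -> 0 < Im w -> N%:R * f.[w] != (w - xi) * f^`().[w].
Proof.
move=> N0 szf fN xi0 w0.
have f0 : f != 0 by apply: contraTneq (fN w w0) => ->; rewrite horner0 eqxx.
have [s [Ef szs rt]] := poly_factor f0.
have ws : w \notin s by rewrite -rt; apply: fN.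
have sR : {in s, forall r, Im r <= 0}.
  by move=> r; rewrite -rt leNgt => rr; apply: contraL rr => /fN.
have Ed : f^`().[w] = f.[w] * \sum_(r <- s) (w - r)^-1.
  by rewrite Ef derivZ !hornerZ deriv_prod_XsubC // mulrA.
apply/eqP; rewrite Ed mulrCA mulrC => /(mulfI (fN w w0)) E.
have NC : N%:R != 0 :> C by rewrite pnatr_eq0 -lt0n.
have wxi : w - xi != 0 by apply: contra_neq NC => wx; rewrite E wx mul0r.
have {}E : \sum_(r <- s) (w - r)^-1 = N%:R%:C * (w - xi)^-1.
  apply: (mulfI wxi); rewrite -E mulrC mulfVK //.
  by rewrite -[LHS](rmorph_nat (real_complex R)).
(* With [v = 1 / (w - xi)], the disk inequality becomes [|v|^2 (Im w (N - size s) + N Im xi) <= 0],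
   which fails since [size s <= N]. *)
have := sum_inv_disk (w - xi)^-1 w0 sR; rewrite E.
set v := (w - xi)^-1.
have -> : Re (N%:R%:C * v * conjc v) = N%:R * sqmod v by coord; ring.
have -> : Im (N%:R%:C * v) = N%:R * Im v by coord; ring.
have sv : 0 < sqmod v by rewrite sqmod_gt0 invr_eq0.
have -> : Im v = - (Im w - Im xi) * sqmod v.
  by rewrite Im_inv sqmodV; congr (- _ * _); coord.
have NR : 0 < N%:R :> R by rewrite ltr0n.
have szN : (size s)%:R <= N%:R :> R by rewrite ler_nat -ltnS -szs.
have t1 : 0 < N%:R * sqmod v * Im xi by rewrite !mulr_gt0.
have t2 : 0 <= Im w * sqmod v * (N%:R - (size s)%:R).
  by rewrite !mulr_ge0 ?subr_ge0 // ltW.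
move=> H; nra.
Qed.

Lemma horner_ge0_at0 p : (forall e, 0 < e -> 0 <= p.[e]) -> 0 <= p.[0].
Proof.
move=> pe; rewrite leNgt; apply/negP => p0.
have [d d0 dP] := @poly_cont R 0 p (- p.[0]) ltac:(by rewrite oppr_gt0).
have h0 : 0 < d / 2 by lra.
have := dP (d / 2); rewrite subr0 gtr0_norm // => /(_ ltac:(lra)).
by have := pe _ h0; rewrite ltr_norml => ? /andP[]; lra.
Qed.

(* Factor by factor: every zero [r] satisfies [|z0 - r| >= Im z0]. *)
Lemma harnack (D : nat) f z z0 (K := 2 + 2 * sqmod (z - z0) / Im z0 ^+ 2) :
  (size f <= D)%N -> 0 < Im z0 -> (forall w, 0 < Im w -> f.[w] != 0) ->
  sqmod f.[z] <= K ^+ D * sqmod f.[z0].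
Proof.
move=> szf z00 fN.
have f0 : f != 0 by apply: contraTneq (fN z0 z00) => ->; rewrite horner0 eqxx.
have [s [Ef szs rt]] := poly_factor f0.
have sR : {in s, forall r, Im r <= 0}.
  by move=> r; rewrite -rt leNgt => rr; apply: contraL rr => /fN.
have K2 : 2 <= K by rewrite lerDl mulr_ge0 ?invr_ge0 ?sqr_ge0 ?mulr_ge0 ?sqmod_ge0.
have K1 : 1 <= K by lra.
suff H : sqmod f.[z] <= K ^+ size s * sqmod f.[z0].
  apply: (le_trans H); apply: ler_wpM2r; first exact: sqmod_ge0.
  by rewrite ler_weXn2l // ltnW // -szs.
rewrite Ef !hornerZ !sqmodM mulrCA ler_wpM2l ?sqmod_ge0 //.
rewrite !horner_prod_XsubC !sqmod_prod {Ef szs szf rt}.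
elim: s sR => [|r s IHs] sR; first by rewrite !big_nil expr0 mulr1.
rewrite !big_cons exprS mulrACA; apply: ler_pM; rewrite ?sqmod_ge0 //.
- by apply: prodr_ge0 => x _; apply: sqmod_ge0.
- have r0 := sR r (mem_head _ _).
  have q0 : 0 < Im z0 ^+ 2 by rewrite exprn_gt0.
  have d0 : Im z0 ^+ 2 <= sqmod (z0 - r).
    by coord; have := sqr_ge0 (Re z0 - Re r); nra.
  have a0 : 0 <= sqmod (z - z0) / Im z0 ^+ 2 by rewrite divr_ge0 ?sqmod_ge0 // ltW.
  have a1 : sqmod (z - z0) = sqmod (z - z0) / Im z0 ^+ 2 * Im z0 ^+ 2.
    by rewrite divfK // gt_eqF.
  have tri : sqmod (z - r) <= 2 * sqmod (z - z0) + 2 * sqmod (z0 - r).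
    coord; have := sqr_ge0 (Re z + Re r - 2 * Re z0).
    by have := sqr_ge0 (Im z + Im r - 2 * Im z0); nra.
  rewrite /K; set a := _ / _ in a0 a1.
  apply: (le_trans tri); rewrite -mulrA -/a a1; nra.
- by apply: IHs => x xs; apply: sR; rewrite inE xs orbT.
Qed.

Lemma horner2_map (F : {poly {poly C}}) z w :
  (map_poly (fun f => f.[z]) F).[w] = F.[w%:P].[z].
Proof.
have h0 : (0 : {poly C}).[z] = 0 by rewrite horner0.
have szm : (size (map_poly (fun f => f.[z]) F) <= size F)%N by apply: size_poly.
rewrite (horner_coef_wide _ szm) [F.[_]]horner_coef horner_sum.
by apply: eq_bigr => i _; rewrite coef_map_id0 // !hornerE.
Qed.

(** A degree bound uniform in [w], so that the exponent in [harnack] stays fixed along a family. *)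
Lemma size_horner_polyC (F : {poly {poly C}}) w :
  (size F.[w%:P] <= \max_(i < size F) size (F`_i)%R)%N.
Proof.
rewrite horner_coef; apply: (leq_trans (size_sum _ _ _)).
apply/bigmax_leqP => i _; rewrite -polyC_exp mulrC mul_polyC.
apply: (leq_trans (size_scale_leq _ _)).
exact: leq_bigmax.
Qed.

(** [harnack] bounds [|F(e)(z)|^2] by a multiple of [|F(e)(z0)|^2] with a factor independent of [e].
    As [e] tends to 0, one zero [z0] of [F(0)] in the upper half-plane forces [F(0)] to vanish
    identically. *)
Lemma hurwitz (F : {poly {poly C}}) :
  (forall e : R, 0 < e -> forall z, 0 < Im z -> F.[e%:C%:P].[z] != 0) ->
  F.[0] = 0 \/ forall z, 0 < Im z -> F.[0].[z] != 0.
Proof.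
move=> FN; have [->|F0] := eqVneq F.[0] 0; [by left|right=> z0 z00].
apply: contra_neq F0 => Fz0; apply/eqP; rewrite -[_ == 0]negbK.
apply/negP => F0; set f := F.[0] in Fz0 F0.
pose D := (\max_(i < size F) size (F`_i)%R)%N.
suff fz z : f.[z] = 0.
  (* A polynomial vanishing everywhere would have the root [M], which exceeds the real parts of all
     its roots. *)
  have [s [Ef _ _]] := poly_factor F0.
  pose M := (\sum_(x <- s) `|Re x| + 1)%:C.
  suff : M \in s.
    move=> Ms; have : `|Re M| <= \sum_(x <- s) `|Re x|.
      by rewrite (big_rem _ Ms) /= lerDl sumr_ge0.
    have S0 : 0 <= \sum_(x <- s) `|Re x| by apply: sumr_ge0.
    by rewrite Re_real ger0_norm; lra.
  by rewrite -(root_scale_prod s M (c := lead_coef f)) ?lead_coef_eq0 // -Ef /root fz.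
pose K := 2 + 2 * sqmod (z - z0) / Im z0 ^+ 2.
(* [(G y).[e]] is the squared modulus of [F(e)(y)], as a real polynomial in [e]. *)
pose G y : {poly R} := let h := map_poly (fun f => f.[y]) F in
  repoly h ^+ 2 + impoly h ^+ 2.
have GE y (e : R) : (G y).[e] = sqmod F.[e%:C%:P].[y].
  by rewrite /G !hornerE -Re_horner -Im_horner horner2_map.
have : 0 <= (K ^+ D *: G z0 - G z).[0].
  apply: horner_ge0_at0 => e e0; rewrite hornerD hornerN hornerZ !GE subr_ge0.
  by apply: harnack => //; [apply: size_horner_polyC | apply: FN].
rewrite hornerD hornerN hornerZ !GE -/f Fz0 sqmod0 mulr0 sub0r oppr_ge0.
by rewrite le_eqVlt ltNge sqmod_ge0 orbF sqmod_eq0 => /eqP.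
Qed.

End Stability.

(** * Grace and the sufficiency of (c) and (d) *)

Section Symbols.
Variable R : realType.
Local Notation C := R[i].
Local Notation Re := (@complex.Re R).
Local Notation Im := (@complex.Im R).
Implicit Types (x y z w : C) (f g : {poly C}) (p q : {poly R}).
Implicit Types (L : {linear {poly C} -> {poly C}}).

Lemma horner_zpw n w : (zpw R n).[w%:P] = ('X + w%:P) ^+ n.
Proof. by rewrite /zpw !hornerE. Qed.
Lemma horner_zmw n w : (zmw R n).[w%:P] = ('X - w%:P) ^+ n.
Proof. by rewrite /zmw !hornerE. Qed.

Lemma coef_zpw n i : (i <= n)%N -> (zpw R n)`_i = 'X^(n - i) *+ 'C(n, i).
Proof.
move=> lein; rewrite /zpw exprDn coef_sum (bigD1 (inord i)) //= inordK //.
rewrite big1 => [|j ji]; last first.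
  rewrite -polyC_exp coefMn coefCM coefXn -(inj_eq val_inj) /= inordK // in ji *.
  by rewrite eq_sym (negPf ji) mulr0 mul0rn.
by rewrite addr0 coefMn -polyC_exp coefCM coefXn eqxx mulr1.
Qed.

Lemma coef_zmw n i : (i <= n)%N ->
  (zmw R n)`_i = (-1) ^+ i * 'X^(n - i) *+ 'C(n, i).
Proof.
move=> lein; rewrite /zmw exprBn coef_sum (bigD1 (inord i)) //= inordK //.
have E (j : nat) : (-1) ^+ j * 'X%:P ^+ (n - j) * 'X^j =
    ((-1) ^+ j * 'X^(n - j))%:P * 'X^j :> {poly {poly C}}.
  by rewrite polyCM !polyC_exp !polyCN.
rewrite big1 => [|j ji]; last first.
  rewrite E coefMn coefCM coefXn -(inj_eq val_inj) /= inordK // in ji *.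
  by rewrite eq_sym (negPf ji) mulr0 mul0rn.
by rewrite addr0 E coefMn coefCM coefXn eqxx mulr1.
Qed.

Lemma size_zpw n : (size (zpw R n) <= n.+1)%N.
Proof.
rewrite /zpw addrC (leq_trans (size_poly_exp_leq _ _)) //.
by rewrite size_XaddC mul1n.
Qed.

Lemma horner_map_linear L (F : {poly {poly C}}) w :
  (map_poly L F).[w%:P] = L F.[w%:P].
Proof.
have szm : (size (map_poly L F) <= size F)%N by apply: size_poly.
rewrite (horner_coef_wide _ szm) horner_coef linear_sum.
apply: eq_bigr => i _; rewrite coef_map /= -!polyC_exp ![_ * (_ ^+ _)%:P]mulrC.
by rewrite !mul_polyC linearZ.
Qed.

(* Grace's theorem, for the functional [l] apolar to
   [w |-> l (('X + w) ^+ N)]; each factor ['X - r] acts as a polar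
   derivative with pole [- r]. *)
Lemma grace (rs : seq C) (l : {poly C} -> C)
  (hl : forall a f g, l (a *: f + g) = a * l f + l g) :
  {in rs, forall r, Im r < 0} ->
  (forall w, 0 < Im w -> l (('X + w%:P) ^+ size rs) != 0) ->
  l (\prod_(r <- rs) ('X - r%:P)) != 0.
Proof.
elim: rs l hl => [|r rs IHrs] l hl rsN lN.
  have := lN 'i%C; rewrite big_nil /= expr0; apply; exact: ltr01.
have lD f g : l (f + g) = l f + l g by rewrite -{1}[f]scale1r hl mul1r.
have l0 : l 0 = 0 by apply: (addrI (l 0)); rewrite -lD !addr0.
have lZ a f : l (a *: f) = a * l f by rewrite -[a *: f]addr0 hl l0 addr0.
have lMn f k : l (f *+ k) = l f *+ k.
  by elim: k => [|k IHk]; rewrite ?mulr0n // !mulrS lD IHk.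
have lS (I : Type) (s : seq I) (F : I -> {poly C}) :
    l (\sum_(i <- s) F i) = \sum_(i <- s) l (F i).
  exact: (big_morph l lD l0).
rewrite big_cons; set n := size rs in IHrs.
have r0 : Im r < 0 := rsN r (mem_head _ _).
apply: (IHrs (fun h => l (('X - r%:P) * h))) => [a f g|x xs|w w0].
- by rewrite mulrDr lD -scalerAr lZ.
- by apply: rsN; rewrite inE xs orbT.
have lH F w1 : (map_poly l F).[w1] = l F.[w1%:P].
  have szm : (size (map_poly l F) <= size F)%N by apply: size_poly.
  rewrite (horner_coef_wide _ szm) horner_coef lS.
  apply: eq_bigr => i _; rewrite coef_map_id0 //.
  by rewrite -!polyC_exp [_ * (_ ^+ _)%:P]mulrC mul_polyC lZ mulrC.
(* [A] is [w |-> l (('X + w) ^+ n.+1)]; its derivative in [w] is [n.+1] times the same expression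
   with exponent [n]. *)
pose A := map_poly l (zpw R n.+1).
have AE w1 : A.[w1] = l (('X + w1%:P) ^+ n.+1) by rewrite lH horner_zpw.
have dA : A^`().[w] = n.+1%:R * l (('X + w%:P) ^+ n).
  have -> : A^`() = map_poly l (zpw R n.+1)^`().
    by apply/polyP => i; rewrite coef_deriv !coef_map_id0 // coef_deriv lMn.
  rewrite lH /zpw deriv_exp derivD derivC derivX add0r mul1r hornerMn lMn.
  by rewrite -/(zpw R n) horner_zpw mulr_natl.
have szA : (size A <= n.+2)%N by rewrite (leq_trans (size_poly _ _)) ?size_zpw.
have AN z : 0 < Im z -> A.[z] != 0 by move=> z0; rewrite AE lN.
have r0' : 0 < Im (- r) by rewrite ImN oppr_gt0.
have := polar_derivative_neq0 (ltn0Sn n) szA AN r0' w0.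
(* If [l (('X - r) * ('X + w) ^+ n) = 0], then ['X + w = ('X - r) + (w + r)] gives
   [n.+1 * A(w) = (w + r) * A'(w)], which the polar derivative excludes. *)
rewrite opprK dA AE; apply: contra_neq => E.
have -> : l (('X + w%:P) ^+ n.+1) = (w + r) * l (('X + w%:P) ^+ n).
  rewrite -lZ -[RHS]add0r -E -lD; congr l.
  by rewrite exprS -mul_polyC polyCD; ring.
by ring.
Qed.

End Symbols.

(** * Stable symbols give preservers of real-rootedness *)

Section Sufficiency.
Variable R : realType.
Local Notation C := R[i].
Local Notation Re := (@complex.Re R).
Local Notation Im := (@complex.Im R).
Implicit Types (x y z w : C) (f g : {poly C}) (p q : {poly R}).
Implicit Types (L : {linear {poly C} -> {poly C}}).

(** Zeros of a real polynomial come in conjugate pairs, so excluding the upper half-plane excludes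
    the lower one. *)
Lemma real_stable_realrooted f : realpoly f ->
  (forall z, 0 < Im z -> f.[z] != 0) -> piR f.
Proof.
move=> fR fN; split.
  by apply: contraTneq (fN 'i%C ltr01) => ->; rewrite horner0 eqxx.
apply/realrootedP => z rz.
have [z0|z0|//] := ltgtP (Im z) 0.
  have := fN (conjc z); rewrite ImJ oppr_gt0 => /(_ z0).
  by rewrite {1}(realpolyE fR) horner_rpolyJ -(realpolyE fR) (rootP rz) conjc0 eqxx.
by have := fN z z0; rewrite -/(root f z) rz.
Qed.

(** Grace's theorem wants exactly [n] zeros in the open lower half-plane; real-rooted polynomials of
    degree at most [n] are limits of such, and [hurwitz] passes to the limit. *)
Lemma stable_symbol n L :
  (forall z w, 0 < Im z -> 0 < Im w -> (L (('X + w%:P) ^+ n)).[z] != 0) ->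
  forall s : seq R, (size s <= n)%N ->
  L (rpoly (\prod_(x <- s) ('X - x%:P))) = 0 \/
  forall z, 0 < Im z -> (L (rpoly (\prod_(x <- s) ('X - x%:P)))).[z] != 0.
Proof.
move=> LN s sn.
(* The zeros of [s] are moved down by [e], and the [n - size s] zeros at
   infinity become zeros at [- i / e]. *)
pose F : {poly {poly C}} :=
  \prod_(x <- s) (('X - x%:C%:P)%:P + 'i%C%:P%:P * 'X)
  * (1 - ('i%C *: 'X)%:P * 'X) ^+ (n - size s).
have FE (e : C) : F.[e%:P] = \prod_(x <- s) ('X - (x%:C - 'i%C * e)%:P)
    * (1 - ('i%C * e) *: 'X) ^+ (n - size s).
  rewrite /F hornerM horner_exp horner_prod; congr (_ * _ ^+ _).
    apply: eq_bigr => x _; rewrite !hornerE polyCB polyCM; ring.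
  by rewrite !hornerE -!mul_polyC polyCM; ring.
have F0 : F.[0] = rpoly (\prod_(x <- s) ('X - x%:P)).
  rewrite -polyC0 FE mulr0 scale0r subr0 expr1n mulr1 rpoly_prod.
  by apply: eq_bigr => x _; rewrite subr0.
have := @hurwitz R (map_poly L F).
rewrite -{2 3}polyC0 !horner_map_linear polyC0 F0; apply=> e e0 z z0.
rewrite horner_map_linear FE.
set k : C := 'i%C * e%:C.
have k0 : k != 0.
  rewrite mulf_neq0 //; first by rewrite eq_complex /= oner_eq0 andbF.
  by rewrite eq_complex /= gt_eqF.
(* Here [1 - k X = - k (X - 1/k)], and [1/k = - i / e] lies in the lower half-plane; the padding
   gives [rs] exactly [n] entries. *)
pose rs : seq C := map (fun x : R => x%:C - k) s ++ nseq (n - size s) k^-1.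
have -> : \prod_(x <- s) ('X - (x%:C - k)%:P) * (1 - k *: 'X) ^+ (n - size s)
  = (- k) ^+ (n - size s) *: \prod_(r <- rs) ('X - r%:P).
  rewrite /rs big_cat /= big_map scalerAr; congr (_ * _).
  rewrite big_nseq iter_mulr_1 -exprZn; congr (_ ^+ _).
  rewrite scalerBr -[_ *: _%:P]mul_polyC -polyCM mulNr mulfV //.
  by rewrite polyCN opprK polyC1 scaleNr addrC.
rewrite linearZ hornerZ mulf_neq0 ?expf_neq0 ?oppr_eq0 //.
apply: (grace (l := fun f => (L f).[z])).
- by move=> a f g; rewrite linearP !hornerE.
- move=> r; rewrite mem_cat => /orP[/mapP[x xs ->]|].
    by rewrite /k; coord; lra.
  rewrite mem_nseq => /andP[_ /eqP ->]; rewrite Im_inv mulNr oppr_lt0.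
  by rewrite divr_gt0 ?sqmod_gt0 // /k; coord; lra.
move=> w w0; rewrite size_cat size_map size_nseq subnKC //; exact: LN.
Qed.

(** Common to (c) and (d): [eta L] is real on real polynomials of degree at most [n], and stability
    of the image then gives real zeros. *)
Lemma preserver_of_symbol n L (eta : C) : eta != 0 ->
  (forall z w, 0 < Im z -> 0 < Im w -> (L (('X + w%:P) ^+ n)).[z] != 0) ->
  (forall k, (k <= n)%N -> realpoly (eta *: L 'X^k)) ->
  forall f, polyle n f -> piR f -> piR (L f) \/ L f = 0.
Proof.
move=> eta0 LN LR f szf [f0 fR].
have [s Ef] := realrooted_factor f0 fR.
set p := rpoly _ in Ef.
have lf0 : lead_coef f != 0 by rewrite lead_coef_eq0.
have szp : size p = (size s).+1 by rewrite size_rpoly size_prod_XsubC.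
have sn : (size s <= n)%N.
  by rewrite -ltnS -szp (leq_trans _ szf) // [in X in (_ <= X)%N]Ef size_scale.
have [p0|pN] := stable_symbol LN sn.
  by right; rewrite Ef linearZ /= p0 scaler0.
left; rewrite Ef linearZ /= -/p.
have pE : p = \sum_(k < (size s).+1) ((repoly p)`_k)%:C *: 'X^k.
  rewrite -[LHS]coefK poly_def szp; apply: eq_bigr => k _.
  by rewrite -coef_rpoly /p rpolyK.
have lpR : realpoly (eta *: L p).
  apply/realpolyP => j; rewrite pE linear_sum scaler_sumr coef_sum.
  rewrite (big_morph Im (@ImD R) (erefl (Im 0))) big1 // => k _.
  rewrite linearZ /= scalerA mulrC -scalerA coefZ ImM Im_real mul0r addr0.
  have kn : (k <= n)%N by rewrite (leq_trans _ sn) // -ltnS.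
  have /realpolyP -> := LR k kn; exact: mulr0.
have [lp0 lpr] : piR (eta *: L p).
  by apply: real_stable_realrooted => // z z0; rewrite hornerZ mulf_neq0 ?pN.
split.
  by move: lp0; rewrite !scaler_eq0 !negb_or => /andP[_ ->]; rewrite lf0.
by move=> z; rewrite rootZ // => rz; apply: lpr; rewrite rootZ.
Qed.

Lemma preserver_of_zpw n L (eta : C) :
  H2R (eta%:P *: map_poly L (zpw R n)) ->
  forall f, polyle n f -> piR f -> piR (L f) \/ L f = 0.
Proof.
move=> [F0 FR FN].
have eta0 : eta != 0 by apply: contraNneq F0 => ->; rewrite polyC0 scale0r.
apply: (preserver_of_symbol eta0) => [z w z0 w0|k kn].
  have := FN z w; rewrite !NumIm_gt0 => /(_ z0 w0).
  rewrite hornerZ horner_map_linear horner_zpw hornerM hornerC.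
  by rewrite mulf_eq0 negb_or => /andP[].
(* The coefficient of [w^(n-k)] in the symbol is [L 'X^k] times a non-zero binomial number, so its
   reality after scaling by [eta] passes to [eta *: L 'X^k]. *)
apply/realpolyP => j; have /NumIm_eq0 := FR (n - k)%N j.
have B0 : ('C(n, n - k))%:R != 0 :> R.
  by rewrite pnatr_eq0 -lt0n bin_gt0 leq_subr.
rewrite coefZ coef_map /= coef_zpw ?leq_subr // subKn // mul_polyC.
rewrite raddfMn /= !coefZ coefMn -mulr_natr -(rmorph_nat (real_complex R)).
rewrite mulrA [Im (_ * _%:C)]ImM Im_real Re_real mulr0 add0r.
by move/eqP; rewrite mulf_eq0 (negPf B0) orbF => /eqP.
Qed.

Lemma preserver_of_zmw n L (eta : C) :
  H2R (eta%:P *: map_poly L (zmw R n)) ->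
  forall f, polyle n f -> piR f -> piR (L f) \/ L f = 0.
Proof.
move=> [F0 FR FN].
have eta0 : eta != 0 by apply: contraNneq F0 => ->; rewrite polyC0 scale0r.
(* Substituting [- z] for [z] before applying [L] turns [(z - w)^n] into [(z + w)^n] up to sign; it
   preserves degree and real-rootedness. *)
pose M : {linear {poly C} -> {poly C}} := L \o comp_poly (- 'X).
have ME f : M f = L (f \Po - 'X) by [].
have MN z w : 0 < Im z -> 0 < Im w -> (M (('X + w%:P) ^+ n)).[z] != 0.
  move=> z0 w0; have := FN z w; rewrite !NumIm_gt0 => /(_ z0 w0).
  rewrite hornerZ horner_map_linear horner_zmw hornerM hornerC.
  rewrite mulf_eq0 negb_or => /andP[_]; apply: contra_neq.
  rewrite ME rmorphXn /= comp_polyD comp_polyX comp_polyC.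
  have -> : (- 'X + w%:P) ^+ n = (-1) ^+ n *: ('X - w%:P) ^+ n.
    by rewrite -exprZn scaleN1r opprB addrC.
  rewrite linearZ hornerZ => /eqP; rewrite mulf_eq0 expf_eq0.
  by rewrite oppr_eq0 oner_eq0 andbF => /eqP.
have MR k : (k <= n)%N -> realpoly (eta *: M 'X^k).
  move=> kn; apply/realpolyP => j.
  rewrite ME comp_Xn_poly exprNn -(signr_odd _ k).
  have := FR (n - k)%N j => /NumIm_eq0.
  have B0 : ('C(n, n - k))%:R != 0 :> R.
    by rewrite pnatr_eq0 -lt0n bin_gt0 leq_subr.
  rewrite coefZ coef_map /= coef_zmw ?leq_subr // subKn // mul_polyC.
  rewrite -(signr_odd _ (n - k)).
  rewrite raddfMn !coefZ coefMn -mulr_natr -(rmorph_nat (real_complex R)).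
  rewrite mulrA [Im (_ * _%:C)]ImM Im_real Re_real mulr0 add0r.
  move=> /eqP; rewrite mulf_eq0 (negPf B0) orbF => /eqP.
  case: odd; case: odd; rewrite ?expr0 ?expr1 ?mul1r ?mulN1r ?raddfN //= ?coefN
    ?mulrN ?ImN // => /eqP; by rewrite ?oppr_eq0 => /eqP -> //; rewrite oppr0.
move=> f szf [f0 fR].
have szN : size (- 'X : {poly C}) = 2 by rewrite size_polyN size_polyX.
have fN : (f \Po - 'X) \Po - 'X = f.
  by rewrite -comp_polyA raddfN /= comp_polyX opprK comp_polyXr.
have := preserver_of_symbol eta0 MN MR (f := f \Po - 'X).
rewrite ME fN; apply.
  by rewrite /polyle size_comp_poly2.
split; first by rewrite -size_poly_eq0 size_comp_poly2 // size_poly_eq0.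
apply/realrootedP => z; rewrite /root horner_comp hornerN hornerX => rz.
have /realrootedP/(_ (- z) rz) := fR.
by rewrite ImN => /eqP; rewrite oppr_eq0 => /eqP.
Qed.

End Sufficiency.

(** * Interlacing zeros and real pencils *)

Section InterlacingPencil.
Variable R : realType.
Local Notation C := R[i].
Local Notation Re := (@complex.Re R).
Local Notation Im := (@complex.Im R).
Implicit Types (x y z w : C) (f g : {poly C}) (p q : {poly R}).
Implicit Types (a b s : seq R).

(** Dropping the smallest zero exchanges the roles of the two sequences, which drives the induction
    below. *)
Lemma interl_behead (a0 : R) a b : interl (a0 :: a) b ->
  interl b a /\ ((0 < size b)%N -> a0 <= b`_0).
Proof.
case=> /= /andP[s1 s2] H1 H2; split; last by move=> b0; apply: (H1 0%N).
split=> [|i ia|i ib ia].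
- by rewrite -ltnS s2 s1.
- apply: (H2 i); first by rewrite ltnS.
  by rewrite (leq_trans ia).
- exact: (H1 i.+1).
Qed.

(* With [0 < arg (c - z) < pi] decreasing in [c], the argument of
   [A * conj B] is an alternating sum of decreasing angles, hence it lies
   between [0] and the first of them. *)
Lemma interl_cone z a b (c : R) : Im z < 0 -> interl a b ->
  ((0 < size a)%N -> c <= a`_0) ->
  exists r s : R, [/\ 0 <= r, 0 <= s &
    \prod_(x <- a) (x%:C - z) * conjc (\prod_(x <- b) (x%:C - z))
    = r%:C + s%:C * (c%:C - z)].
Proof.
move=> z0; have [n] := ubnP (size a + size b).
elim: n => // n IHn in a b c * => + ab ca.
case: a ab ca => [|a0 a] ab ca.
  case: ab; rewrite leqn0 => /andP[/eqP/size0nil -> _] _ _ _.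
  exists 1, 0; split=> //; rewrite !big_nil mul0r addr0 conjc1; exact: mulr1.
have {ab} [ba a0b] := interl_behead ab.
rewrite /= addSn addnC ltnS => /IHn/(_ ba a0b) [r [s [r0 s0 E]]].
have {}ca : c <= a0 by apply: ca.
(* By induction the product for [b] and [a] is [r + s (a0 - z)]; its conjugate is multiplied by
   [a0 - z = (a0 - c) + (c - z)]. *)
exists (r * (a0 - c) + s * sqmod (a0%:C - z)), r; split=> //.
  by rewrite addr_ge0 ?mulr_ge0 ?sqmod_ge0 ?subr_ge0.
rewrite big_cons -mulrA -[X in _ * (X * _)]conjcK -rmorphM mulrC /= mulrC.
rewrite [X in conjc X]mulrC E.
by apply: complex_eqP; coord; ring.
Qed.

(** For [e > 0], a zero of [p + (t + i e) q] in the upper half-plane would give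
    [Im (p conj q) = - e |q|^2 < 0]. Then [e] tends to 0 and [hurwitz] applies. *)
Lemma nonneg_pencil p q :
  (forall z, 0 < Im z -> (rpoly q).[z] != 0) ->
  (forall z, 0 < Im z -> 0 <= Im ((rpoly p).[z] * conjc (rpoly q).[z])) ->
  forall al be : R, al *: p + be *: q = 0 \/ piR (rpoly (al *: p + be *: q)).
Proof.
move=> qN pq al be.
have [->|al0] := eqVneq al 0.
  have [->|be0] := eqVneq be 0; first by left; rewrite !scale0r addr0.
  right; apply: real_stable_realrooted; first exact: realpoly_rpoly.
  move=> z z0; rewrite scale0r add0r rpolyZ hornerZ mulf_neq0 ?qN //.
  by rewrite fmorph_eq0.
pose t := be / al.
have -> : al *: p + be *: q = al *: (p + t *: q).
  by rewrite scalerDr scalerA /t mulrCA mulfV // mulr1.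
pose F : {poly {poly C}} :=
  (rpoly (p + t *: q))%:P + ('i%C *: rpoly q)%:P * 'X.
have F0 : F.[0] = rpoly (p + t *: q) by rewrite /F hornerD hornerM hornerX mulr0 addr0 hornerC.
have [e e0 z z0||] := @hurwitz R F.
- rewrite /F !hornerE rpolyD rpolyZ !hornerE.
  apply/eqP => E; have := pq z z0.
  have -> : (rpoly p).[z] = - (t%:C + 'i%C * e%:C) * (rpoly q).[z].
    by apply/eqP; rewrite mulNr -subr_eq0 opprK -E; apply/eqP; ring.
  rewrite -mulrA mulcJ; coord.
  have : 0 < sqmod (rpoly q).[z] by rewrite sqmod_gt0 qN.
  by rewrite /sqmod; clear -e0 => ? ?; nra.
- rewrite F0 => /eqP; rewrite rpoly_eq0 => /eqP ->.
  by left; rewrite scaler0.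
rewrite F0 => FN; right; apply: real_stable_realrooted.
  exact: realpoly_rpoly.
move=> z z0; rewrite rpolyZ hornerZ mulf_neq0 ?FN //.
by rewrite fmorph_eq0.
Qed.

(** The cone estimate at [conjc z] fixes the sign of [Im (p conj q)] up to the sign [sg] from
    replacing the factors [x - z] by [z - x]; so [nonneg_pencil] applies to [p] and [- sg q]. *)
Lemma interl_pencil a b (al be : R) : interl a b ->
  let F := al *: \prod_(x <- a) ('X - x%:P) + be *: \prod_(x <- b) ('X - x%:P) in
  F = 0 \/ piR (rpoly F).
Proof.
move=> ab; set p := \prod_(x <- a) _; set q := \prod_(x <- b) _.
pose sg : R := (-1) ^+ (size a + size b).
have sg2 : sg * sg = 1 by rewrite -expr2 -exprM muln2 -signr_odd odd_double.
have hE s z : (rpoly (\prod_(x <- s) ('X - x%:P))).[z]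
    = ((-1) ^+ size s : R)%:C * \prod_(x <- s) (x%:C - z).
  rewrite rpoly_prod horner_prod.
  elim: s => [|x s IHs]; first by rewrite !big_nil expr0 mul1r.
  have -> : ((-1) ^+ size (x :: s) : R)%:C = - ((-1) ^+ size s : R)%:C.
    by rewrite exprS mulN1r rmorphN.
  by rewrite !big_cons IHs hornerXsubC; ring.
have qN z : 0 < Im z -> (rpoly q).[z] != 0.
  move=> z0; rewrite -/(root _ _) rpoly_prod -(big_map _ predT (fun y => 'X - y%:P)).
  rewrite root_prod_XsubC; apply: contraTN z0 => /mapP[x _ ->].
  by rewrite Im_real ltxx.
have /= := @nonneg_pencil p ((- sg) *: q) _ _ al (- (be * sg)).
rewrite scalerA mulrNN -mulrA sg2 mulr1; apply.
  move=> z z0; rewrite rpolyZ hornerZ mulf_neq0 ?qN //.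
  by rewrite fmorph_eq0 oppr_eq0 signr_eq0.
move=> z z0.
have z1 : Im (conjc z) < 0 by rewrite ImJ oppr_lt0.
have [r [s [r0 s0 E]]] := interl_cone (c := a`_0) z1 ab (fun _ => lexx _).
have hJ h : (rpoly h).[z] = conjc (rpoly h).[conjc z].
  by rewrite horner_rpolyJ conjcK.
rewrite rpolyZ hornerZ (hJ p) (hJ q) hE hE.
set A := \prod_(x <- a) _ in E *; set B := \prod_(x <- b) _ in E *.
have -> : conjc (((-1) ^+ size a : R)%:C * A)
    * conjc ((- sg)%:C * conjc (((-1) ^+ size b : R)%:C * B))
    = - conjc (A * conjc B).
  have sgE : sg = (-1) ^+ size a * (-1) ^+ size b by rewrite /sg exprD.
  move: sg2; rewrite sgE; set u := _ ^+ _; set v := _ ^+ _ => uv.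
  rewrite -[- conjc _]mul1r -(rmorph1 (real_complex R)) -uv.
  by apply: complex_eqP; coord; ring.
by rewrite E; coord; clear -z0 s0; nra.
Qed.

(** The leading coefficients are real and are absorbed into [al] and [be], which leaves monic
    products over the zeros. *)
Lemma interlacing_pencil f g (al be : C) : realpoly f -> realpoly g ->
  interlacing f g -> Im al = 0 -> Im be = 0 ->
  al *: f + be *: g = 0 \/ piR (al *: f + be *: g).
Proof.
move=> fR gR [a [b [[_ Ea] [_ Eb] I]]] al0 be0.
have lR h : realpoly h -> lead_coef h = (Re (lead_coef h))%:C.
  by move=> /realpolyP hR; rewrite -realE //; apply: hR.
rewrite [al]realE // [be]realE // Ea Eb !scalerA (lR f) // (lR g) //.
rewrite -!rmorphM -!rpoly_prod -!rpolyZ -rpolyD.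
case: I => I.
  by case: (interl_pencil (Re al * Re (lead_coef f))
    (Re be * Re (lead_coef g)) I) => /= [->|]; [left; apply: rmorph0|right].
rewrite addrC.
by case: (interl_pencil (Re be * Re (lead_coef g))
  (Re al * Re (lead_coef f)) I) => /= [->|]; [left; apply: rmorph0|right].
Qed.

End InterlacingPencil.

(** * Counting functions of real zeros *)

Section RootCounting.
Variable R : realType.
Implicit Types (p q : {poly R}) (a b s : seq R) (x y : R).

Lemma count_ltn (T : Type) (P Q : pred T) (s : seq T) :
  subpred P Q -> has (fun t => Q t && ~~ P t) s -> (count P s < count Q s)%N.
Proof.
move=> PQ; elim: s => //= t s IHs /orP[/andP[-> /negPf ->]|/IHs].
  by rewrite add0n add1n ltnS; apply: sub_count.
by have := PQ t; case: (P t) => [->|_] //; case: (Q t) => //= ?; lia.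
Qed.

(* At two consecutive zeros of [p] the derivative of [p] has opposite signs,
   hence so has [q] when the Wronskian keeps its sign. *)
Lemma zero_between p q a x1 x2 :
  (forall x, root p x -> x \in a) ->
  (forall x y, 0 < (p^`().[x] * q.[x] - p.[x] * q^`().[x])
                 * (p^`().[y] * q.[y] - p.[y] * q^`().[y])) ->
  x1 < x2 -> root p x1 -> root p x2 -> exists2 y, x1 < y < x2 & root q y.
Proof.
(* Induction on the number of entries of [a] strictly between [x1] and [x2] reduces to consecutive
   zeros of [p]. *)
move=> pa W; have [n] := ubnP (count (fun t => x1 < t < x2) a).
elim: n => // n IHn in x1 x2 *; rewrite ltnS => cn x12 r1 r2.
have [/hasP[x3 x3a /andP[/andP[x13 x32] r3]]|noroot] :=
  boolP (has (fun t => (x1 < t < x2) && root p t) a).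
  have [|//|//|y /andP[y1 y2] ry] := IHn x1 x3 _ x13.
    apply: leq_trans cn; apply: count_ltn => [t /andP[-> t3]|].
      by rewrite (lt_trans t3).
    by apply/hasP; exists x3 => //; rewrite x13 x32 ltxx.
  by exists y => //; rewrite y1 (lt_trans y2).
have nr y : x1 < y < x2 -> ~~ root p y.
  move=> yI; apply: contra noroot => ry; apply/hasP; exists y; rewrite ?pa //.
  by rewrite yI.
have [p1 Ep1] := factor_theorem _ _ r1.
have r21 : root p1 x2.
  move: r2; rewrite Ep1 rootM root_XsubC => /orP[//|/eqP E].
  by rewrite E ltxx in x12.
have [s Es] := factor_theorem _ _ r21.
have Ep : p = s * ('X - x2%:P) * ('X - x1%:P) by rewrite Ep1 Es.
have d1 : p^`().[x1] = s.[x1] * (x1 - x2).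
  by rewrite Ep !derivM !derivXsubC !hornerE subrr; ring.
have d2 : p^`().[x2] = s.[x2] * (x2 - x1).
  by rewrite Ep !derivM !derivXsubC !hornerE subrr; ring.
have := W x1 x2; rewrite d1 d2 (rootP r1) (rootP r2) !mul0r !subr0 => W12.
(* Without zeros of [p] in between, the cofactor [s] has the same sign at both ends; the Wronskian
   then forces [q] to change sign. *)
have s12 : 0 < s.[x1] * s.[x2].
  rewrite lt_def; apply/andP; split.
    apply: contraTneq W12 => s0.
    have -> : s.[x1] * (x1 - x2) * q.[x1] * (s.[x2] * (x2 - x1) * q.[x2])
      = s.[x1] * s.[x2] * ((x1 - x2) * q.[x1] * ((x2 - x1) * q.[x2])) by ring.
    by rewrite s0 mul0r ltxx.
  rewrite leNgt; apply/negP => sN.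
  have [y yI ry] := poly_ivtoo (ltW x12) sN.
  by have := nr y; rewrite in_itv /= in yI; rewrite yI Ep !rootM ry => /(_ isT).
have q12 : q.[x1] * q.[x2] < 0.
  rewrite ltNge; apply/negP => q0.
  have := mulr_ge0 q0 (ltW s12); have : 0 < (x2 - x1) ^+ 2.
    by rewrite exprn_gt0 // subr_gt0.
  by move=> h1 h2; have := mulr_ge0 h2 (ltW h1); lra.
by have [y yI ry] := poly_ivtoo (ltW x12) q12; exists y; rewrite // in_itv in yI.
Qed.

(** The gaps between successive entries of [u :: s] are disjoint and each contains an entry of
    [b]. *)
Lemma count_path u s b : path <%R u s ->
  {in u :: s &, forall x y, x < y -> exists2 t, x < t < y & t \in b} ->
  (size s <= count (fun t => (u < t < last u s)%R) b)%N.
Proof.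
elim: s u => //= v s IHs u /andP[uv vs] H.
have vl : v <= last v s.
  move: vs; rewrite lt_path_sortedE => /andP[/allP al _].
  by have := mem_last v s; rewrite inE => /orP[/eqP ->//|/al/ltW].
have {}IHs : (size s <= count (fun t => (v < t < last v s)%R) b)%N.
  by apply: IHs => // x y xs ys; apply: H; rewrite inE ?xs ?ys orbT.
have [|t /andP[ut tv] tb] := H u v (mem_head _ _) _ uv.
  by rewrite !inE eqxx orbT.
apply: (leq_ltn_trans IHs); apply: count_ltn => [x /andP[vx ->]|].
  by rewrite (lt_trans uv).
apply/hasP; exists t => //; by rewrite ut (lt_le_trans tv vl) (lt_gtF tv).
Qed.

Lemma count_interval x y s : x <= y ->
  count (<= y) s = (count (<= x) s + count (fun t => (x < t <= y)%R) s)%N.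
Proof.
move=> xy; elim: s => //= t s ->.
have [tx|tx] := leP t x; first by rewrite (le_trans tx xy); lia.
by case: (t <= y) => /=; lia.
Qed.

(** Entries of [a] in []x, y]] are separated by entries of [b], so over this interval the count of
    [a] grows by at most one more than that of [b]. *)
Lemma count_separated a b x y : sorted <%R a ->
  {in a &, forall u v, u < v -> exists2 t, u < t < v & t \in b} ->
  x <= y ->
  (count (<= y) a + count (<= x) b <= count (<= y) b + count (<= x) a + 1)%N.
Proof.
move=> sa H xy; rewrite !(count_interval _ xy) -(size_filter (fun t => (x < t <= y)%R) a).
set a' := filter _ a.
have gen (i j k l : nat) : (j <= l + 1)%N -> (i + j + k <= k + l + i + 1)%N.
  by lia.
apply: gen.
have sa' : sorted <%R a' by apply: sorted_filter => //; apply: lt_trans.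
have a'I t : t \in a' -> [/\ x < t, t <= y & t \in a].
  by rewrite mem_filter => /andP[/andP[-> ->] ->].
case: a' sa' a'I => //= u s us a'I.
rewrite addn1 ltnS; apply: (leq_trans (count_path us (b := b) _)).
  by move=> v w /a'I[_ _ va] /a'I[_ _ wa]; apply: H.
apply: sub_count => t /andP[ut tl].
have [xu _ _] := a'I u (mem_head _ _); rewrite (lt_trans xu ut) /=.
by have [_ ly _] := a'I _ (mem_last u s); apply: ltW; apply: lt_le_trans ly.
Qed.

Lemma exists_lower y s : exists2 x, x <= y & {in s, forall t, x < t}.
Proof.
elim: s => [|t s [x xy xs]]; first by exists y.
exists (Num.min x (t - 1)); first by rewrite ge_min xy.
move=> u; rewrite inE => /orP[/eqP ->|/xs xu].
  by rewrite gt_min ltrBlDr ltrDl ltr01 orbT.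
by rewrite gt_min xu.
Qed.

Lemma exists_upper s : exists x, {in s, forall t, t <= x}.
Proof.
elim: s => [|t s [x xs]]; first by exists 0.
exists (Num.max x t) => u; rewrite inE => /orP[/eqP ->|/xs xu].
  by rewrite le_max lexx orbT.
by rewrite le_max xu.
Qed.

(** Counting functions add up under concatenation, so in this form zeros shared by two polynomials
    can be treated separately. *)
Lemma interl_count a b : sorted <=%R a -> sorted <=%R b ->
  (forall x, (count (<= x) b <= count (<= x) a <= (count (<= x) b).+1)%N) ->
  interl a b.
Proof.
move=> sa sb H.
(* The entries of [s] up to index [i] are all at most the one at [i], hence the strict
   inequality. *)
have self s i : sorted <=%R s -> (i < size s)%N -> (i < count (<= nth 0%R s i) s)%N.
  move=> ss iS; rewrite ltnNge; apply/negP => ci.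
  by have := nth_count_gt 0 ss (x := nth 0 s i) (i := i); rewrite ci iS ltxx => /(_ isT).
split.
- have [x xs] := exists_upper (a ++ b).
  have cE s : {subset s <= a ++ b} -> count (<= x) s = size s.
    by move=> sab; apply/eqP; rewrite -all_count; apply/allP => t /sab/xs.
  by have := H x; rewrite !cE // => t tb; rewrite mem_cat tb ?orbT.
- move=> i ib; apply: nth_count_le => //.
  by have /andP[h _] := H b`_i; apply: leq_trans h; apply: self.
- move=> i ia ib; apply: nth_count_le => //.
  by have /andP[_ h] := H a`_i.+1; rewrite -ltnS; apply: leq_trans h; apply: self.
Qed.

End RootCounting.

(** * From real-rooted pencils to interlacing zeros *)

Section PencilInterlacing.
Variable R : realType.
Local Notation C := R[i].
Local Notation Re := (@complex.Re R).
Local Notation Im := (@complex.Im R).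
Implicit Types (x y z w : C) (f g : {poly C}) (p q : {poly R}).

Lemma real_dependence x y : Im (x * conjc y) = 0 ->
  exists a b : R, (a != 0) || (b != 0) /\ a%:C * x + b%:C * y = 0.
Proof.
move=> xy; have [->|y0] := eqVneq y 0.
  by exists 0, 1; rewrite oner_eq0 orbT mul0r mulr0 addr0.
(* Since [x conj y] is real, multiplying the combination by [conj y] makes its two terms cancel. *)
exists (sqmod y), (- Re (x * conjc y)); rewrite sqmod_eq0 y0; split=> //.
have yJ0 : conjc y != 0 by rewrite conjc_eq0.
apply: (mulIf yJ0); rewrite mul0r mulrDl -!mulrA mulcJ (realE xy) Re_real.
by rewrite -!rmorphM -rmorphD; apply/eqP; rewrite fmorph_eq0; apply/eqP; ring.
Qed.

(** Two points are joined by a segment inside the product of half-planes; along it [V] is a real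
    polynomial in [t], and a change of sign would produce a zero. *)
Lemma nonvanishing_sign (V : C -> C -> R) :
  (forall z z' w w', exists h : {poly R}, forall t : R,
     V (z + t%:C * (z' - z)) (w + t%:C * (w' - w)) = h.[t]) ->
  (forall z w, 0 < Im z -> 0 < Im w -> V z w != 0) ->
  (forall z w, 0 < Im z -> 0 < Im w -> 0 < V z w) \/
  (forall z w, 0 < Im z -> 0 < Im w -> V z w < 0).
Proof.
move=> Vp VN.
have V12 z z' w w' : 0 < Im z -> 0 < Im z' -> 0 < Im w -> 0 < Im w' ->
    0 < V z w * V z' w'.
  move=> z0 z1 w0 w1; have [h hE] := Vp z z' w w'.
  have h0 : h.[0] = V z w by rewrite -hE mul0r !addr0 mul0r addr0.
  have h1 : h.[1] = V z' w'.
    by rewrite -hE rmorph1 !mul1r [z + _]addrC [w + _]addrC !subrK.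
  have seg (u v : C) (t : R) : 0 < Im u -> 0 < Im v -> 0 <= t <= 1 ->
      0 < Im (u + t%:C * (v - u)).
    by move=> u0 v0 /andP[t0 t1]; coord; nra.
  rewrite lt_def mulf_neq0 ?VN //= leNgt -h0 -h1; apply/negP => hN.
  have [t] := poly_ivtoo ler01 hN; rewrite in_itv /= => /andP[t0 t1] rt.
  have t01 : 0 <= t <= 1 by rewrite !ltW.
  by have := VN _ _ (seg _ _ _ z0 z1 t01) (seg _ _ _ w0 w1 t01); rewrite hE -/(root h t) rt.
have i0 : 0 < Im 'i%C := ltr01.
have [Vi|Vi|Vi] := ltgtP 0 (V 'i%C 'i%C).
- by left=> z w z0 w0; have := V12 _ z _ w i0 z0 i0 w0; rewrite pmulr_rgt0.
- by right=> z w z0 w0; have := V12 _ z _ w i0 z0 i0 w0; rewrite nmulr_rgt0.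
- by have := VN _ _ i0 i0; rewrite -Vi eqxx.
Qed.

Lemma horner_line f z z' (t : R) :
  (f \Po (z%:P + (z' - z) *: 'X)).[t%:C] = f.[z + t%:C * (z' - z)].
Proof. by rewrite horner_comp !hornerE mulrC. Qed.

(** If [Im (p conj q)] vanished at [z] in the upper half-plane, a non-trivial real combination of
    [p] and [q] would vanish there, against independence or real-rootedness. *)
Lemma pencil_sign p q :
  (forall a b : R, a *: p + b *: q = 0 -> a = 0 /\ b = 0) ->
  (forall a b : R, a *: p + b *: q = 0 \/ piR (rpoly (a *: p + b *: q))) ->
  (forall z, 0 < Im z -> 0 < Im ((rpoly p).[z] * conjc (rpoly q).[z])) \/
  (forall z, 0 < Im z -> Im ((rpoly p).[z] * conjc (rpoly q).[z]) < 0).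
Proof.
move=> indep pen.
pose V z (w : C) := Im ((rpoly p).[z] * conjc (rpoly q).[z]).
have [z z' w w'|z w z0 _|H|H] := @nonvanishing_sign V.
- set l := z%:P + (z' - z) *: 'X.
  exists (impoly (rpoly p \Po l) * repoly (rpoly q \Po l)
         - repoly (rpoly p \Po l) * impoly (rpoly q \Po l)) => t.
  rewrite /V -!horner_line -/l; coord; rewrite !hornerE -!Im_horner -!Re_horner.
  ring.
- apply/eqP => /real_dependence [a [b [ab E]]].
  have [/indep[a0 b0]|[_ /realrootedP/(_ z)]] := pen a b.
    by move: ab; rewrite a0 b0 eqxx.
  rewrite /root rpolyD !rpolyZ !hornerE E eqxx => /(_ isT) Ez.
  by rewrite Ez ltxx in z0.
- by left=> z z0; apply: (H z 'i%C) => //; apply: ltr01.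
- by right=> z z0; apply: (H z 'i%C) => //; apply: ltr01.
Qed.

Lemma rpoly_i_inj p q p' q' : rpoly p + 'i%C *: rpoly q = rpoly p' + 'i%C *: rpoly q' ->
  p = p' /\ q = q'.
Proof.
move=> E; split; apply/polyP => j; move: (congr1 (fun f : {poly C} => f`_j) E);
  rewrite !coefD !coefZ !coef_rpoly.
- by move/(congr1 Re); coord; rewrite !mul0r !mulr0 !subrr !addr0.
- by move/(congr1 Im); coord; rewrite !mul0r !mul1r !add0r.
Qed.

(** Hermite-Biehler: at a zero of [p + i q] one has [p conj q = - i |q|^2], so the sign given by
    [pencil_sign] excludes one open half-plane. *)
Lemma hb_halfplane p q :
  (forall a b : R, a *: p + b *: q = 0 -> a = 0 /\ b = 0) ->
  (forall a b : R, a *: p + b *: q = 0 \/ piR (rpoly (a *: p + b *: q))) ->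
  exists sg : R, (sg != 0) /\
   forall z, root (rpoly p + 'i%C *: rpoly q) z -> sg * Im z <= 0.
Proof.
move=> indep pen; have [H|H] := pencil_sign indep pen.
  exists 1; rewrite oner_eq0; split=> // z rz; rewrite mul1r leNgt.
  apply/negP => z0; have := H z z0.
  have -> : (rpoly p).[z] = - 'i%C * (rpoly q).[z].
    by move: rz; rewrite /root !hornerE addr_eq0 mulNr => /eqP.
  rewrite -mulrA mulcJ; coord; apply/negP; rewrite -leNgt.
  have := sqr_ge0 (Re (rpoly q).[z]); have := sqr_ge0 (Im (rpoly q).[z]).
  by clear => ? ?; lra.
exists (-1); rewrite oppr_eq0 oner_eq0; split=> // z rz; rewrite mulN1r oppr_le0 leNgt.
apply/negP => z0; have z1 : 0 < Im (conjc z) by rewrite ImJ oppr_gt0.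
have := H _ z1; rewrite !horner_rpolyJ.
have -> : (rpoly p).[z] = - 'i%C * (rpoly q).[z].
  by move: rz; rewrite /root !hornerE addr_eq0 mulNr => /eqP.
rewrite rmorphM -mulrA mulcJ; coord; apply/negP; rewrite -leNgt.
have := sqr_ge0 (Re (rpoly q).[z]); have := sqr_ge0 (Im (rpoly q).[z]).
by clear => ? ?; lra.
Qed.

Lemma rpoly_factor p : p != 0 -> realrooted (rpoly p) ->
  exists s : seq R, p = lead_coef p *: \prod_(x <- s) ('X - x%:P).
Proof.
move=> p0 pR; have [|s Es] := realrooted_factor _ pR; first by rewrite rpoly_eq0.
exists s; apply: (@rpoly_inj R); rewrite rpolyZ {1}Es; congr (_ *: _).
by rewrite lead_coef_map.
Qed.

Lemma root_factor p (s : seq R) (x : R) : p != 0 ->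
  p = lead_coef p *: \prod_(y <- s) ('X - y%:P) -> root p x = (x \in s).
Proof. by move=> p0 ->; rewrite rootZ ?lead_coef_eq0 // root_prod_XsubC. Qed.

Lemma uniq_simple_roots p (s : seq R) : p != 0 ->
  p = lead_coef p *: \prod_(y <- s) ('X - y%:P) ->
  (forall x : R, root p x -> p^`().[x] != 0) -> uniq s.
Proof.
elim: s p => //= t s IHs p p0 Ep ps; apply/andP; split.
  apply/negP => ts; have := ps t; rewrite (root_factor _ p0 Ep) mem_head.
  move=> /(_ isT)/eqP; apply; rewrite Ep derivZ big_cons derivM hornerZ hornerD.
  rewrite !hornerM hornerXsubC subrr mul0r addr0.
  suff -> : (\prod_(j <- s) ('X - j%:P)).[t] = 0 by rewrite !mulr0.
  by apply/rootP; rewrite root_prod_XsubC.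
have k0 : \prod_(j <- s) ('X - j%:P) != 0 :> {poly R}.
  by rewrite monic_neq0 // monic_prod_XsubC.
apply: (IHs _ k0).
  by rewrite (monicP (monic_prod_XsubC _ _ _)) scale1r.
move=> x rx; have := ps x; rewrite (root_factor _ p0 Ep) inE.
rewrite -(root_prod_XsubC s) rx orbT => /(_ isT); apply: contra_neq => dx.
by rewrite Ep derivZ big_cons derivM !hornerE dx (rootP rx) !mulr0 addr0 mulr0.
Qed.

Lemma leq_of_leq_add (i j k l : nat) :
  (l < j)%N -> (i + j <= k + l + 1)%N -> (i <= k)%N.
Proof. lia. Qed.

(** The real zeros of [p + i q] are split off as a common factor [G]. For the quotients the
    Wronskian has constant sign on the real line, so their zeros are simple and separate one
    another; the zeros of [G] are added back at the end. *)
Lemma interlacing_of_pencil p q :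
  (forall a b : R, a *: p + b *: q = 0 -> a = 0 /\ b = 0) ->
  (forall a b : R, a *: p + b *: q = 0 \/ piR (rpoly (a *: p + b *: q))) ->
  interlacing (rpoly p) (rpoly q).
Proof.
move=> indep pen; have [sg [sg0 rside]] := hb_halfplane indep pen.
have pair_neq0 (a b : R) : (a, b) != (0, 0) -> a *: p + b *: q != 0.
  by apply: contra_neq => /indep[-> ->].
have p0 : p != 0.
  have := pair_neq0 1 0; rewrite scale1r scale0r addr0; apply.
  by rewrite xpair_eqE oner_eq0.
have q0 : q != 0.
  have := pair_neq0 0 1; rewrite scale1r scale0r add0r; apply.
  by rewrite xpair_eqE oner_eq0 andbF.
have pR : realrooted (rpoly p).
  by have := pen 1 0; rewrite scale1r scale0r addr0 => -[/eqP|[]//]; rewrite (negPf p0).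
have qR : realrooted (rpoly q).
  by have := pen 0 1; rewrite scale1r scale0r add0r => -[/eqP|[]//]; rewrite (negPf q0).
set f := rpoly p + 'i%C *: rpoly q in rside.
have f0 : f != 0.
  apply: contra_neq p0 => f0; have [] // := @rpoly_i_inj p q 0 0.
  by rewrite -/f f0 /rpoly !rmorph0 scaler0 addr0.
have [rs [Ef _ rt]] := poly_factor f0.
pose isr (z : C) := Im z == 0.
pose G : {poly R} := \prod_(r <- rs | isr r) ('X - (Re r)%:P).
pose ns := [seq r <- rs | ~~ isr r].
pose f1 := lead_coef f *: \prod_(r <- ns) ('X - r%:P).
have EG : f = rpoly G * f1.
  rewrite /f1 -scalerAr {1}Ef /ns big_filter (bigID isr) /=; congr (_ *: (_ * _)).
  rewrite /G /rpoly rmorph_prod; apply: eq_bigr => r /eqP rr.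
  by rewrite rmorphB /= map_polyX map_polyC /= -realE.
set p1 := repoly f1; set q1 := impoly f1.
(* [G] is real, so it divides the real and the imaginary part of [f] separately. *)
have [Ep Eq] : p = G * p1 /\ q = G * q1.
  apply: rpoly_i_inj; rewrite -/f EG {1}[f1]poly_ReIm !rpolyM -/p1 -/q1.
  by rewrite mulrDr scalerAr.
have nsI r : r \in ns -> sg * Im r < 0.
  rewrite mem_filter /isr => /andP[r0 rrs].
  by rewrite lt_neqAle mulf_neq0 //= rside // rt.
(* Otherwise [p1] and [q1] are constants, and [p] and [q] are proportional. *)
have ns0 : ns != [::].
  apply/eqP => n0.
  have f1E : f1 = (lead_coef f)%:P by rewrite /f1 n0 big_nil alg_polyC.
  have p1E : p1 = (Re (lead_coef f))%:P.
    by apply/polyP => j; rewrite coef_repoly f1E !coefC; case: eqP.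
  have q1E : q1 = (Im (lead_coef f))%:P.
    by apply/polyP => j; rewrite coef_impoly f1E !coefC; case: eqP.
  have [|a0 /eqP] := indep (Im (lead_coef f)) (- Re (lead_coef f)).
    by rewrite Ep Eq p1E q1E -!mul_polyC polyCN; ring.
  rewrite oppr_eq0 => /eqP b0.
  move: q0; rewrite Eq q1E a0 polyC0 mulr0 eqxx //.
(* This Wronskian is [- Im (f1' conj f1)], that is [- |f1|^2] times the imaginary part of the sum of
   the [1 / (x - r)]; every term has the sign of [Im r], and the sum is not empty. *)
have W (x : R) : 0 < sg * (p1^`().[x] * q1.[x] - p1.[x] * q1^`().[x]).
  have xns : x%:C \notin ns by rewrite mem_filter /isr eqxx.
  have ED : f1^`().[x%:C] = f1.[x%:C] * \sum_(r <- ns) (x%:C - r)^-1.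
    by rewrite /f1 derivZ !hornerZ deriv_prod_XsubC // mulrA.
  have f1x : f1.[x%:C] != 0.
    rewrite -/(root _ _) /f1 root_scale_prod ?lead_coef_eq0 //.
  have E1 : Re f1^`().[x%:C] = p1^`().[x].
    rewrite Re_horner; congr _.[_]; apply/polyP => j.
    by rewrite coef_deriv !coef_repoly coef_deriv ReMn.
  have E2 : Im f1^`().[x%:C] = q1^`().[x].
    rewrite Im_horner; congr _.[_]; apply/polyP => j.
    by rewrite coef_deriv !coef_impoly coef_deriv ImMn.
  have -> : p1^`().[x] * q1.[x] - p1.[x] * q1^`().[x]
     = - Im (f1^`().[x%:C] * conjc f1.[x%:C]).
    by coord; rewrite -E1 -E2 -Re_horner -Im_horner; ring.
  rewrite ED mulrAC mulcJ; set S := \sum_(_ <- _) _.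
  have -> : Im ((sqmod f1.[x%:C])%:C * S) = sqmod f1.[x%:C] * Im S by coord; ring.
  rewrite mulrN oppr_gt0 mulrCA pmulr_rlt0 ?sqmod_gt0 //.
  have term r : r \in ns -> sg * Im (x%:C - r)^-1 < 0.
    move=> rn; rewrite Im_inv mulrA pmulr_llt0.
      by coord; rewrite add0r opprK nsI.
    rewrite invr_gt0 sqmod_gt0 subr_eq0; apply: contraNneq xns => ->; exact: rn.
  suff gen l : l != [::] -> (forall r, r \in l -> sg * Im (x%:C - r)^-1 < 0) ->
      sg * Im (\sum_(r <- l) (x%:C - r)^-1) < 0 by apply: gen.
  case: l => // r s _ {}term.
  have h1 := term r (mem_head _ _).
  suff h2 : sg * Im (\sum_(t <- s) (x%:C - t)^-1) <= 0.
    by rewrite big_cons ImD mulrDr; lra.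
  have {}term t : t \in s -> sg * Im (x%:C - t)^-1 < 0.
    by move=> ts; apply: term; rewrite inE ts orbT.
  elim: s term => [|t s IHs] term; first by rewrite big_nil mulr0.
  have h2 := term t (mem_head _ _).
  have h3 := IHs (fun u us => term u (mem_behead (s := t :: s) us)).
  by rewrite big_cons ImD mulrDr; lra.
pose Wr (x : R) := p1^`().[x] * q1.[x] - p1.[x] * q1^`().[x].
have WW (x y : R) : 0 < Wr x * Wr y.
  have := mulr_gt0 (W x) (W y); rewrite -/(Wr x) -/(Wr y) mulrACA pmulr_rgt0 //.
  by rewrite -expr2 exprn_even_gt0.
have p10 : p1 != 0 by apply: contra_neq p0 => E; rewrite Ep E mulr0.
have q10 : q1 != 0 by apply: contra_neq q0 => E; rewrite Eq E mulr0.
have G0 : G != 0 by apply: contra_neq q0 => E; rewrite Eq E mul0r.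
have [a Ea] : exists a, p1 = lead_coef p1 *: \prod_(x <- a) ('X - x%:P).
  by apply: (rpoly_factor p10) => z rz; apply: pR; rewrite Ep rpolyM rootM rz orbT.
have [b Eb] : exists b, q1 = lead_coef q1 *: \prod_(x <- b) ('X - x%:P).
  by apply: (rpoly_factor q10) => z rz; apply: qR; rewrite Eq rpolyM rootM rz orbT.
have [gs Eg] : exists gs, G = lead_coef G *: \prod_(x <- gs) ('X - x%:P).
  by apply: (rpoly_factor G0) => z rz; apply: pR; rewrite Ep rpolyM rootM rz.
have ra (x : R) : root p1 x = (x \in a) by apply: root_factor.
have rb (x : R) : root q1 x = (x \in b) by apply: root_factor.
have WN (x : R) : Wr x != 0.
  by apply/eqP => w0; have := WW x x; rewrite w0 mul0r ltxx.
have ua : uniq a.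
  apply: (uniq_simple_roots p10) => // x /rootP rx; apply: contra_neq (WN x) => dx.
  by rewrite /Wr rx dx !mul0r subrr.
have ub : uniq b.
  apply: (uniq_simple_roots q10) => // x /rootP rx; apply: contra_neq (WN x) => dx.
  by rewrite /Wr rx dx !mulr0 subrr.
pose a' := sort <=%R a; pose b' := sort <=%R b.
have sa' : sorted <%R a' by rewrite lt_sorted_uniq_le sort_uniq ua sort_le_sorted.
have sb' : sorted <%R b' by rewrite lt_sorted_uniq_le sort_uniq ub sort_le_sorted.
have sep1 : {in a' &, forall u v, u < v -> exists2 t, u < t < v & t \in b'}.
  move=> u v; rewrite !mem_sort -!ra => ru rv uv.
  have [|t tI rt'] := @zero_between _ p1 q1 a u v _ WW uv ru rv.
    by move=> x; rewrite ra.
  by exists t; rewrite // mem_sort -rb.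
have sep2 : {in b' &, forall u v, u < v -> exists2 t, u < t < v & t \in a'}.
  move=> u v; rewrite !mem_sort -!rb => ru rv uv.
  have [||t tI rt'] := @zero_between _ q1 p1 b u v _ _ uv ru rv.
  - by move=> x; rewrite rb.
  - move=> x y; have := WW x y; congr (0 < _); rewrite /Wr; ring.
  by exists t; rewrite // mem_sort -ra.
have cmp1 (x y : R) : x <= y -> _ := @count_separated _ a' b' x y sa' sep1.
have cmp2 (x y : R) : x <= y -> _ := @count_separated _ b' a' x y sb' sep2.
have cnt0 (y : R) : exists2 x : R, x <= y & count (<= x) a' = 0%N /\ count (<= x) b' = 0%N.
  have [x xy xs] := exists_lower y (a' ++ b'); exists x => //.
  by split; apply/eqP; rewrite -leqn0 leqNgt -has_count; apply/hasPn => t ts;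
    rewrite -ltNge xs // mem_cat ts ?orbT.
(* Comparison with a point below all zeros, where both counts are 0, shows that the counts differ by
   at most one. *)
have near (y : R) : (count (<= y) a' <= (count (<= y) b').+1)%N /\
              (count (<= y) b' <= (count (<= y) a').+1)%N.
  have [x xy [xa xb]] := cnt0 y.
  by have := cmp1 x y xy; have := cmp2 x y xy; rewrite xa xb !addn0 !addn1.
pose A := sort <=%R (a ++ gs); pose B := sort <=%R (b ++ gs).
have cA (x : R) : count (<= x) A = (count (<= x) a' + count (<= x) gs)%N.
  rewrite (permP (permEl (perm_sort _ _))) count_cat; congr (_ + _)%N.
  by rewrite -(permP (permEl (perm_sort <=%R a))).
have cB (x : R) : count (<= x) B = (count (<= x) b' + count (<= x) gs)%N.
  rewrite (permP (permEl (perm_sort _ _))) count_cat; congr (_ + _)%N.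
  by rewrite -(permP (permEl (perm_sort <=%R b))).
have zs (h k : {poly R}) (s : seq R) : h != 0 -> h = G * k ->
    k = lead_coef k *: \prod_(x <- s) ('X - x%:P) ->
    zeroseq (rpoly h) (sort <=%R (s ++ gs)).
  move=> h0 Eh Ek; split; first exact: sort_le_sorted.
  have Eh' : h = lead_coef h *: \prod_(x <- s ++ gs) ('X - x%:P).
    rewrite Eh lead_coefM big_cat /= {1}Ek {1}Eg -scalerAl -scalerAr scalerA.
    by rewrite mulrC [X in _ *: X]mulrC -mulrC.
  rewrite {1}Eh' rpolyZ rpoly_prod lead_coef_map; congr (_ *: _).
  by apply: perm_big; rewrite perm_sym perm_sort.
exists A, B; split; [exact: (zs p p1)|exact: (zs q q1)|].
have sA : sorted <=%R A := sort_le_sorted _.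
have sB : sorted <=%R B := sort_le_sorted _.
(* If [a'] is ahead of [b'] at one point, separation keeps it from falling behind anywhere;
   otherwise [b'] is never behind. *)
have [[x Ex]|nx] := boolp.EM (exists x : R, (count (<= x) b' < count (<= x) a')%N).
  left; apply: interl_count => // y; rewrite cA cB.
  have [nx1 nx2] := near x; have [ny1 ny2] := near y.
  have yab : (count (<= y) b' <= count (<= y) a')%N.
    case: (leP x y) => [xy|/ltW yx].
      exact: leq_of_leq_add Ex (cmp2 x y xy).
    apply: leq_of_leq_add Ex _.
    by rewrite addnC [X in (_ <= X + 1)%N]addnC; apply: cmp1.
  by rewrite leq_add2r yab -addSn leq_add2r.
right; apply: interl_count => // y; rewrite cA cB.
have [ny1 ny2] := near y.
have yab : (count (<= y) a' <= count (<= y) b')%N.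
  by rewrite leqNgt; apply/negP => h; apply: nx; exists y.
by rewrite leq_add2r yab -addSn leq_add2r.
Qed.

End PencilInterlacing.

(** * Perturbation of simple real zeros *)

Section Perturbation.
Variable R : realType.
Local Notation C := R[i].
Local Notation Re := (@complex.Re R).
Local Notation Im := (@complex.Im R).
Implicit Types (x y z w : C) (f g : {poly C}) (p q : {poly R}).

Lemma small_all (T : eqType) (s : seq T) (P : T -> R -> Prop) :
  {in s, forall t, exists2 d : R, 0 < d & forall e, 0 < e < d -> P t e} ->
  exists2 d : R, 0 < d & forall e, 0 < e < d -> {in s, forall t, P t e}.
Proof.
elim: s => [|t s IHs] H; first by exists 1.
have [|d d0 Hd] := IHs; first by move=> u us; apply: H; rewrite inE us orbT.
have [d' d'0 Hd'] := H t (mem_head _ _).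
exists (Num.min d d'); first by rewrite lt_min d0.
move=> e /andP[e0]; rewrite lt_min => /andP[ed ed'] u.
by rewrite inE => /orP[/eqP ->|us]; [apply: Hd'|apply: Hd]; rewrite ?e0.
Qed.

Lemma poly_sign_near p (x : R) : p.[x] != 0 ->
  exists2 d : R, 0 < d & forall y : R, `|y - x| < d -> 0 < p.[y] * p.[x].
Proof.
move=> px; have [d d0 Hd] := @poly_cont R x p `|p.[x]| ltac:(by rewrite normr_gt0).
exists d => // y /Hd; have [p0|p0|/esym/eqP] := ltgtP 0 p.[x]; last by rewrite (negPf px).
  by rewrite (gtr0_norm p0) ltr_norml => /andP[h _]; rewrite mulr_gt0 //; lra.
by rewrite (ltr0_norm p0) ltr_norml => /andP[_ h]; rewrite nmulr_lgt0 //; lra.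
Qed.

Lemma sign_change p q (x : R) : p = q * ('X - x%:P) -> q.[x] != 0 ->
  exists2 d : R, 0 < d & forall e, 0 < e < d -> p.[x - e] * p.[x + e] < 0.
Proof.
move=> -> qx; have [d d0 Hd] := poly_sign_near qx; exists d => // e /andP[e0 ed].
have h1 : 0 < q.[x - e] * q.[x].
  by apply: Hd; rewrite addrAC subrr add0r normrN gtr0_norm.
have h2 : 0 < q.[x + e] * q.[x].
  by apply: Hd; rewrite addrAC subrr add0r gtr0_norm.
have h3 : 0 < q.[x - e] * q.[x + e].
  have := mulr_gt0 h1 h2; rewrite mulrACA pmulr_lgt0 //.
  by rewrite -expr2 exprn_even_gt0.
have h4 := mulr_gt0 h3 (mulr_gt0 e0 e0).
rewrite !hornerM !hornerXsubC -oppr_gt0; congr (0 < _): h4; ring.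
Qed.

(** Dividing by the linear factors given by [s] leaves a real factor of degree at most one, whose
    zero, if any, is real. *)
Lemma realrooted_of_roots p (s : seq R) : p != 0 -> uniq s -> all (root p) s ->
  (size p <= (size s).+2)%N -> piR (rpoly p).
Proof.
move=> p0 us rs szp; split; first by rewrite rpoly_eq0.
have [|q Eq] := uniq_roots_prod_XsubC rs; first by rewrite uniq_rootsE.
have q0 : q != 0 by apply: contra_neq p0 => E; rewrite Eq E mul0r.
have szq : (size q <= 2)%N.
  move: szp; rewrite Eq size_Mmonic ?monic_prod_XsubC // size_prod_XsubC.
  by rewrite addnS /= -addn2 addnC leq_add2l.
apply/realrootedP => z; rewrite Eq rpolyM rootM rpoly_prod => /orP[|].
  rewrite /root (@horner_coef_wide _ 2) ?size_rpoly //.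
  rewrite !big_ord_recl big_ord0 !coef_rpoly expr0 mulr1 addr0 expr1 => /eqP E.
  have EI := congr1 Im E; have ER := congr1 Re E; move: EI ER.
  coord; rewrite add0r mul0r addr0 => /eqP; rewrite mulf_eq0 => /orP[|/eqP //].
  move=> /eqP q1; rewrite q1 !mul0r subr0 addr0 => q00; case/eqP: q0.
  apply/polyP => -[|[|j]]; rewrite coef0 //.
  by rewrite nth_default // (leq_trans szq).
rewrite -(big_map _ predT (fun y => 'X - y%:P)) root_prod_XsubC.
by move=> /mapP[x _ ->].
Qed.

(** The degree may be [n] or [n - 1]: the real part of [la (z + w)^n] can lose its leading term, and
    a single remaining zero of a real polynomial is forced to be real. *)
Definition simple_rooted (n : nat) p := exists s : seq R,
  [/\ p != 0, p = lead_coef p *: \prod_(x <- s) ('X - x%:P), uniq s,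
      (n <= (size s).+1)%N & (size p <= n.+1)%N].

(** Each simple zero sits in its own small interval at whose ends [p] has opposite signs. A small
    perturbation keeps these signs, so the intervals still contain distinct zeros, and at most one
    zero is left over. *)
Lemma perturb_realrooted n p q : simple_rooted n p -> (size q <= n.+1)%N ->
  exists2 d : R, 0 < d & forall e, 0 < e < d ->
    p + e *: q = 0 \/ piR (rpoly (p + e *: q)).
Proof.
move=> [s [p0 Ep us ns szp]] szq.
(* The condition [2 * e < |y - x|] keeps the intervals of radius [e] around the zeros disjoint. *)
have [d d0 Hd] : exists2 d : R, 0 < d & forall e, 0 < e < d -> {in s, forall x : R,
    p.[x - e] * p.[x + e] < 0 /\ {in s, forall y : R, y != x -> 2 * e < `|y - x|}}.
  apply: small_all => x xs.
  have [d1 d10 H1] : exists2 d : R, 0 < d &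
      forall e, 0 < e < d -> p.[x - e] * p.[x + e] < 0.
    pose h := lead_coef p *: \prod_(y <- rem x s) ('X - y%:P).
    apply: (@sign_change _ h).
      by rewrite {1}Ep (big_rem _ xs) /= /h mulrC scalerAl.
    rewrite -/(root _ _) rootZ ?lead_coef_eq0 // root_prod_XsubC.
    by rewrite mem_rem_uniq // inE eqxx.
  have [d2 d20 H2] : exists2 d : R, 0 < d & forall e, 0 < e < d ->
      {in s, forall y : R, y != x -> 2 * e < `|y - x|}.
    apply: small_all => y ys; have [->|yx] := eqVneq y x; first by exists 1.
    have yx0 : 0 < `|y - x| by rewrite normr_gt0 subr_eq0.
    by exists (`|y - x| / 2) => [|e /andP[e0 ed] _]; lra.
  exists (Num.min d1 d2); first by rewrite lt_min d10.
  move=> e /andP[e0]; rewrite lt_min => /andP[ed1 ed2].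
  by split; [apply: H1|apply: H2]; rewrite e0.
pose eta := d / 2.
have eta0 : 0 < eta < d by rewrite /eta; apply/andP; split; lra.
have Heta := Hd _ eta0; have /andP[{}eta0 _] := eta0.
have {Hd} [d' d'0 Hd] : exists2 d : R, 0 < d & forall e, 0 < e < d -> {in s, forall x : R,
    (p + e *: q).[x - eta] * (p + e *: q).[x + eta] < 0}.
  apply: small_all => x /Heta[px _].
  (* As a polynomial in [e], [k] is the product of the values of [p + e q] at the two ends; it is
     negative at 0, hence for small [e]. *)
  pose k := (p.[x - eta]%:P + q.[x - eta]%:P * 'X)
            * (p.[x + eta]%:P + q.[x + eta]%:P * 'X).
  have kE e : k.[e] = (p + e *: q).[x - eta] * (p + e *: q).[x + eta].
    by rewrite /k !hornerE; ring.
  have k0 : k.[0] < 0 by rewrite kE scale0r addr0.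
  have [|d1 d10 H] := @poly_sign_near k 0; first by rewrite lt_eqF.
  exists d1 => // e /andP[e0 ed]; rewrite -kE.
  by have := H e; rewrite subr0 gtr0_norm // => /(_ ed); rewrite nmulr_lgt0.
exists d' => // e /Hd He; set F := p + _ in He *.
have [->|F0] := eqVneq F 0; [by left|right].
have [s' [szs' us' rs']] : exists s' : seq R,
    [/\ size s' = size s, uniq s' & all (root F) s'].
  have gen (t : seq R) : uniq t -> {subset t <= s} -> exists t' : seq R,
      [/\ size t' = size t, uniq t', all (root F) t' &
      {in t', forall y : R, exists2 x : R, x \in t & `|y - x| < eta}]; last first.
    by have [//|s' [h1 h2 h3 _]] := gen s us; exists s'.
  elim: t => [|x t IHt] /=; first by exists [::].
  move=> /andP[xt ut] ts; have xs := ts x (mem_head _ _).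
  have [|t' [szt' ut' rt' nt']] := IHt ut.
    by move=> y yt; apply: ts; rewrite inE yt orbT.
  have [|y] := poly_ivtoo _ (He x xs); first by lra.
  rewrite in_itv /= => /andP[y1 y2] ry.
  have yx : `|y - x| < eta by rewrite ltr_norml; apply/andP; split; lra.
  exists (y :: t'); split=> /=; rewrite ?szt' ?ry ?ut' ?andbT //.
    apply/negP => /nt'[v vt yv].
    have vx : v != x by apply: contraNneq xt => <-.
    have vs : v \in s by apply: ts; rewrite inE vt orbT.
    have [_ /(_ v vs vx)] := Heta x xs; apply/negP; rewrite -leNgt.
    have -> : v - x = (y - x) - (y - v) by ring.
    by apply: (le_trans (ler_normB _ _)); lra.
  move=> u; rewrite inE => /orP[/eqP ->|/nt'[v vt uv]].
    by exists x; rewrite // mem_head.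
  by exists v; rewrite // inE vt orbT.
apply: (@realrooted_of_roots _ s') => //.
rewrite szs'; apply: leq_trans (_ : n.+1 <= _)%N; last by rewrite ltnS.
rewrite (leq_trans (size_polyD _ _)) // geq_max szp.
by rewrite (leq_trans (size_scale_leq _ _)).
Qed.

Lemma repolyJ f : rpoly (repoly f) *+ 2 = f + map_poly conjc f.
Proof.
apply/polyP => j; rewrite coefMn coefD coef_rpoly coef_repoly coef_map /=.
by apply: complex_eqP; rewrite mulr2n; coord; ring.
Qed.

Lemma mapJ_XaddC_exp w (la : C) n :
  map_poly conjc (la *: ('X + w%:P) ^+ n) = conjc la *: ('X + (conjc w)%:P) ^+ n.
Proof. by rewrite map_polyZ rmorphXn rmorphD /= map_polyX map_polyC. Qed.

Lemma size_exp_XaddC w n : size (('X + w%:P) ^+ n) = n.+1.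
Proof. by rewrite -[w]opprK polyCN size_exp_XsubC. Qed.

Lemma coefpn_XaddC_exp w n : (('X + w%:P) ^+ n.+1)`_n = w *+ n.+1.
Proof.
elim: n => [|n IHn]; first by rewrite expr1 coefD coefX coefC add0r.
have cn : (('X + w%:P) ^+ n.+1)`_n.+1 = 1.
  have /monicP : ('X + w%:P) ^+ n.+1 \is monic by rewrite monic_exp // monicXaddC.
  by rewrite lead_coefE size_exp_XaddC.
by rewrite exprSr mulrDr coefD coefMX coefMC /= IHn cn mul1r -mulrSr.
Qed.

(** A zero [z] of the real part satisfies [|z + w| = |z + conj w|], hence is real. *)
Lemma simple_rooted_rotated_power w (la : C) n : (0 < n)%N -> 0 < Im w ->
  la != 0 -> simple_rooted n (repoly (la *: ('X + w%:P) ^+ n)) /\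
             piR (rpoly (repoly (la *: ('X + w%:P) ^+ n))).
Proof.
case: n => // n _ w0 la0; set f := la *: _; set p := repoly f.
have sX : size (('X + w%:P) ^+ n.+1) = n.+2 by rewrite size_exp_XaddC.
have szp : (size p <= n.+2)%N.
  by rewrite (leq_trans (size_repoly _)) // size_scale // sX.
(* The top coefficient is [Re la]; if it is 0, the next one is a non-zero multiple of
   [Im la * Im w]. *)
have np : (n < size p)%N.
  rewrite ltnNge; apply/negP => pn.
  have c0 : Re la = 0.
    have : p`_n.+1 = 0 by rewrite nth_default // (leq_trans pn).
    rewrite coef_repoly coefZ.
    have -> : (('X + w%:P) ^+ n.+1)`_n.+1 = 1.
      have /monicP : ('X + w%:P) ^+ n.+1 \is monic by rewrite monic_exp // monicXaddC.
      by rewrite lead_coefE sX.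
    by rewrite mulr1.
  have : p`_n = 0 by rewrite nth_default.
  rewrite coef_repoly coefZ coefpn_XaddC_exp mulrnAr ReMn ReM c0 mul0r.
  move=> /eqP; rewrite sub0r -mulr_natr mulf_eq0 pnatr_eq0 orbF oppr_eq0 mulf_eq0.
  rewrite (gt_eqF w0) orbF => /eqP l0.
  by case/eqP: la0; apply: complex_eqP.
have p0 : p != 0 by rewrite -size_poly_gt0 (leq_ltn_trans _ np).
have pR : realrooted (rpoly p).
  apply/realrootedP => z rz.
  have E : f.[z] = - (map_poly conjc f).[z].
    apply/eqP; rewrite -addr_eq0 -hornerD -repolyJ hornerMn.
    by rewrite (rootP rz) mul0rn.
  have {}E : sqmod (z + w) = sqmod (z + conjc w).
    move: (congr1 (@sqmod R) E); rewrite mapJ_XaddC_exp !hornerE.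
    rewrite -mulN1r sqmodM !sqmodM !sqmodX sqmodJ.
    have -> : sqmod (-1 : C) = 1 by coord; rewrite /= oppr0; ring.
    rewrite mul1r => /(mulfI _); rewrite sqmod_eq0 => /(_ la0).
    by apply: (pexpIrn (ltn0Sn n)); rewrite nnegrE sqmod_ge0.
  have : Im z * Im w = 0 by move: E; coord; lra.
  by move=> /eqP; rewrite mulf_eq0 (gt_eqF w0) orbF => /eqP.
have ppi : piR (rpoly p) by split; rewrite ?rpoly_eq0.
split=> //; have [s Es] := rpoly_factor p0 pR; exists s; split=> //.
  apply: (uniq_simple_roots p0 Es) => x /rootP px; apply/eqP => dx.
  have px' : Re f.[x%:C] = 0 by rewrite Re_horner.
  have dx' : Re f^`().[x%:C] = 0.
    rewrite Re_horner -dx; congr _.[_]; apply/polyP => j.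
    by rewrite coef_deriv !coef_repoly coef_deriv ReMn.
  (* At a double zero both [A] and [A (x + w)] are purely imaginary, so [Im A * Im w = 0] and
     [A = 0]. *)
  pose A := la * (x%:C + w) ^+ n.
  have xw0 : x%:C + w != 0.
    apply/eqP => /(congr1 Im); coord; rewrite add0r => E.
    by rewrite E ltxx in w0.
  have A0 : A != 0 by rewrite mulf_neq0 ?expf_neq0.
  have RA : Re A = 0.
    move: dx'; rewrite derivZ deriv_exp derivD derivX derivC addr0 mul1r.
    rewrite hornerZ hornerMn !hornerE mulrnAr ReMn -/A => /eqP.
    by rewrite -mulr_natr mulf_eq0 pnatr_eq0 orbF => /eqP.
  move: px'; rewrite !hornerE exprSr mulrA -/A ReM RA mul0r sub0r.
  move/eqP; rewrite oppr_eq0 mulf_eq0 => /orP[/eqP IA|].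
    by case/eqP: A0; apply: complex_eqP.
  by coord; rewrite add0r (gt_eqF w0).
by move: np; rewrite Es size_scale ?lead_coef_eq0 // size_prod_XsubC.
Qed.

End Perturbation.

(** * Necessity *)

Section Necessity.
Variable R : realType.
Local Notation C := R[i].
Local Notation Re := (@complex.Re R).
Local Notation Im := (@complex.Im R).
Implicit Types (x y z w : C) (f g : {poly C}) (p q : {poly R}).
Implicit Types (L M : {linear {poly C} -> {poly C}}).

Definition realrooted_preserver n L :=
  forall f, polyle n f -> piR f -> piR (L f) \/ L f = 0.

Definition real_operator n L :=
  forall p, (size p <= n.+1)%N -> realpoly (L (rpoly p)).

Lemma rpolyXn n : rpoly ('X^n : {poly R}) = 'X^n.
Proof.
by apply/polyP => j; rewrite coef_rpoly !coefXn; case: eqP => _; rewrite ?rmorph1 ?rmorph0.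
Qed.

Lemma quadratic_coef0 (A B D d : R) : 0 < d ->
  (forall e, 0 < e < d -> A + B * e + D * (e * e) = 0) -> D = 0.
Proof.
move=> d0 H; pose t := d / 4.
have t0 : 0 < t by rewrite /t; lra.
have H1 := H t ltac:(rewrite /t; apply/andP; split; lra).
have H2 := H (2 * t) ltac:(rewrite /t; apply/andP; split; lra).
have H3 := H (3 * t) ltac:(rewrite /t; apply/andP; split; lra).
have : D * (t * t) = 0 by clear -H1 H2 H3; lra.
by move/eqP; rewrite mulf_eq0 (gt_eqF (mulr_gt0 t0 t0)) orbF => /eqP.
Qed.

(** A real-rooted polynomial is a constant times a real one, so its real and imaginary parts are
    proportional. Minors turn this into an algebraic identity that can be expanded under
    perturbation. *)
Lemma realrooted_minors f : piR f \/ f = 0 -> forall j k,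
  Re f`_j * Im f`_k = Re f`_k * Im f`_j.
Proof.
case=> [[f0 fR] j k|-> j k]; last by rewrite !coef0 /= !mulr0.
have [s ->] := realrooted_factor f0 fR.
by rewrite !coefZ !coef_rpoly; coord; ring.
Qed.

Lemma exists_simple_rooted n : (0 < n)%N ->
  exists p, simple_rooted n p /\ piR (rpoly p).
Proof.
move=> n0; exists (repoly (1 *: ('X + ('i%C)%:P) ^+ n)).
by apply: simple_rooted_rotated_power; rewrite ?oner_eq0 // ltr01.
Qed.

(** For a simple-rooted [q], the minors of [L (q + e p)] vanish for all small [e > 0]; they are
    quadratic in [e], with the minor of [L p] as coefficient of [e^2]. *)
Lemma preserver_minors n L : (0 < n)%N -> realrooted_preserver n L ->
  forall p, (size p <= n.+1)%N -> forall j k,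
  Re (L (rpoly p))`_j * Im (L (rpoly p))`_k
  = Re (L (rpoly p))`_k * Im (L (rpoly p))`_j.
Proof.
move=> n0 LP p szp j k; have [q [qs qpi]] := exists_simple_rooted n0.
have [d d0 Hd] := perturb_realrooted qs szp.
have szq : (size q <= n.+1)%N by case: qs => s [].
set a := L (rpoly p); set b := L (rpoly q).
apply/eqP; rewrite -subr_eq0; apply/eqP.
apply: (quadratic_coef0 (A := Re b`_j * Im b`_k - Re b`_k * Im b`_j)
  (B := Re b`_j * Im a`_k + Re a`_j * Im b`_k
        - Re b`_k * Im a`_j - Re a`_k * Im b`_j) d0) => e /Hd He.
have Hr : piR (L (rpoly (q + e *: p))) \/ L (rpoly (q + e *: p)) = 0.
  case: He => [->|qe]; first by right; rewrite /rpoly rmorph0 linear0.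
  apply: LP => //; rewrite /polyle size_rpoly.
  rewrite (leq_trans (size_polyD _ _)) // geq_max szq.
  by rewrite (leq_trans (size_scale_leq _ _)).
have := realrooted_minors Hr j k.
rewrite rpolyD rpolyZ linearD linearZ -/a -/b !coefD !coefZ; coord => H.
by move: H; lra.
Qed.

(** Polarizing the minor identity between [p] and ['X^k], whose image [p0] is real, shows that
    [T2 p] is always a multiple of [p0]. If some [T2 h] is non-zero, the real parts are multiples of
    [p0] too. *)
Lemma rank1_or_real n M k p0 : (0 < n)%N -> realrooted_preserver n M ->
  (k <= n)%N -> M 'X^k = rpoly p0 -> p0 != 0 ->
  (forall p, (size p <= n.+1)%N -> exists c : C, M (rpoly p) = c *: rpoly p0)
  \/ real_operator n M.
Proof.
move=> n0 MP kn Mk p00; have minors := preserver_minors n0 MP.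
have szk : (size ('X^k : {poly R}) <= n.+1)%N by rewrite size_polyXn ltnS.
have Xk := rpolyXn k.
have szD p q : (size p <= n.+1)%N -> (size q <= n.+1)%N -> (size (p + q)%R <= n.+1)%N.
  by move=> sp sq; rewrite (leq_trans (size_polyD _ _)) // geq_max sp.
pose T1 p := repoly (M (rpoly p)); pose T2 p := impoly (M (rpoly p)).
have ME p : M (rpoly p) = rpoly (T1 p) + 'i%C *: rpoly (T2 p).
  exact: poly_ReIm.
have minor p : (size p <= n.+1)%N -> forall i j,
    (T1 p)`_i * (T2 p)`_j = (T1 p)`_j * (T2 p)`_i.
  by move=> sp i j; rewrite !coef_repoly !coef_impoly; apply: minors.
have TD p q : T1 (p + q) = T1 p + T1 q /\ T2 (p + q) = T2 p + T2 q.
  split; apply/polyP => i.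
    by rewrite coefD !coef_repoly rpolyD linearD coefD ReD.
  by rewrite coefD !coef_impoly rpolyD linearD coefD ImD.
have [T1k T2k] : T1 'X^k = p0 /\ T2 'X^k = 0.
  rewrite /T1 /T2 Xk Mk rpolyK; split=> //; apply/polyP => i.
  by rewrite coef_impoly coef_rpoly coef0.
have lp0 : lead_coef p0 != 0 by rewrite lead_coef_eq0.
pose d := (size p0).-1.
have par q : (forall i j, p0`_i * q`_j = p0`_j * q`_i) ->
    q = (q`_d / lead_coef p0) *: p0.
  move=> H; apply/polyP => j; rewrite coefZ mulrAC.
  by apply: (mulIf lp0); rewrite divfK // -[lead_coef p0]/(p0`_d) [RHS]mulrC -H mulrC.
have T2par p : (size p <= n.+1)%N -> exists t : R, T2 p = t *: p0.
  move=> sp; exists ((T2 p)`_d / lead_coef p0); apply: par => // i j.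
  have := minor _ (szD _ _ sp szk) i j; have [-> ->] := TD p 'X^k.
  rewrite T1k T2k addr0 !coefD !mulrDl minor // => /addrI; exact.
have [[h [sh Th]]|nT] := boolp.EM (exists h : {poly R}, (size h <= n.+1)%N /\ T2 h != 0).
  left.
  have T1par p : (size p <= n.+1)%N -> T2 p != 0 -> exists t : R, T1 p = t *: p0.
    move=> sp Tp; have [t Et] := T2par p sp.
    have t0 : t != 0 by apply: contra_neq Tp => t0; rewrite Et t0 scale0r.
    exists ((T1 p)`_d / lead_coef p0); apply: par => // i j.
    have := minor _ sp j i; rewrite Et !coefZ => E.
    by apply: (mulfI t0); move: E; lra.
  have T1all p : (size p <= n.+1)%N -> exists t : R, T1 p = t *: p0.
    move=> sp; have [Tp|Tp] := eqVneq (T2 p) 0; last exact: T1par.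
    (* When [T2 p = 0], the previous case applies to [p + h], whose imaginary part is [T2 h]. *)
    have [u Eu] := T1par h sh Th.
    have [|v] := T1par (p + h) (szD _ _ sp sh).
      by have [_ ->] := TD p h; rewrite Tp add0r.
    have [-> _] := TD p h; rewrite Eu => E; exists (v - u).
    by rewrite scalerBl -E addrK.
  move=> p sp; have [u Eu] := T1all p sp; have [v Ev] := T2par p sp.
  exists (u%:C + 'i%C * v%:C); rewrite ME Eu Ev !rpolyZ.
  by rewrite scalerA -scalerDl.
right=> p sp; have T0 : T2 p = 0.
  by apply/eqP/negPn/negP => Tp; apply: nT; exists p.
rewrite ME T0 /rpoly rmorph0 scaler0 addr0; exact: realpoly_rpoly.
Qed.

Lemma horner_map_comp (A : {poly {poly C}}) (Z W : {poly C}) (t : C) :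
  ((map_poly (comp_poly Z) A).[W]).[t] = A.[(W.[t])%:P].[Z.[t]].
Proof.
have sz : (size (map_poly (comp_poly Z) A) <= size A)%N by apply: size_poly.
rewrite (horner_coef_wide _ sz) [A.[_]]horner_coef !horner_sum.
apply: eq_bigr => i _; rewrite coef_map /= !hornerM !horner_exp hornerC.
by rewrite horner_comp.
Qed.

(** Once [|F(z,w)|^2 - |F(z,conj w)|^2] has a strict constant sign, the larger of the two terms is
    never 0. *)
Lemma symbol_sign n M : (0 < n)%N -> realrooted_preserver n M ->
  (forall p, simple_rooted n p -> M (rpoly p) != 0) ->
  (forall z w, 0 < Im z -> 0 < Im w -> (M (('X + w%:P) ^+ n)).[z] != 0) \/
  (forall z w, 0 < Im z -> 0 < Im w -> (M (('X + (conjc w)%:P) ^+ n)).[z] != 0).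
Proof.
move=> n0 MP inj; pose F z w := (M (('X + w%:P) ^+ n)).[z].
have [z z' w w'|z w z0 w0|H|H] :=
  @nonvanishing_sign R (fun z w => sqmod (F z w) - sqmod (F z (conjc w))).
- pose A := map_poly M (zpw R n).
  have FE u v : F u v = A.[v%:P].[u] by rewrite horner_map_linear horner_zpw.
  pose l (u v : C) : {poly C} := u%:P + (v - u) *: 'X.
  pose B := (map_poly (comp_poly (l z z')) A).[l w w'].
  pose B' := (map_poly (comp_poly (l z z')) A).[l (conjc w) (conjc w')].
  exists (repoly B ^+ 2 + impoly B ^+ 2 - (repoly B' ^+ 2 + impoly B' ^+ 2)) => t.
  have lE u v : (l u v).[t%:C] = u + t%:C * (v - u).
    by rewrite /l !hornerE mulrC.
  have lJ : conjc (w + t%:C * (w' - w)) = conjc w + t%:C * (conjc w' - conjc w).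
    by apply: complex_eqP; coord; ring.
  by rewrite lJ -!lE !FE -!horner_map_comp !hornerE -!Re_horner -!Im_horner.
- apply/eqP => V0; set X := F z w in V0; set Y := F z (conjc w) in V0.
  (* Equal moduli make [X + Y] and [i (X - Y)] dependent over the reals, and [a (X + Y) + b i (X -
     Y) = la X + conj la Y]. This is twice the value at [z] of the image of the real part of
     [la ('X + w)^n]. *)
  have D : Im ((X + Y) * conjc ('i%C * (X - Y))) = 0.
    by move: V0; coord; lra.
  have [a [b [ab E]]] := real_dependence D.
  pose la : C := a%:C + 'i%C * b%:C.
  have la0 : la != 0.
    apply: contraTneq ab => la0.
    have -> : a = Re la by rewrite /la; coord; ring.
    have -> : b = Im la by rewrite /la; coord; ring.
    by rewrite la0 /= eqxx.
  have [sr ppi] := simple_rooted_rotated_power n0 w0 la0.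
  set p := repoly _ in sr ppi.
  have szp : polyle n (rpoly p) by rewrite /polyle size_rpoly; case: sr => s [].
  have [[_ /realrootedP/(_ z) Mz]|/eqP] := MP _ szp ppi; last first.
    by rewrite (negPf (inj p sr)).
  suff rz : root (M (rpoly p)) z by rewrite (Mz rz) ltxx in z0.
  have : (M (rpoly p *+ 2)).[z] = 0.
    rewrite repolyJ mapJ_XaddC_exp linearD !linearZ hornerD !hornerZ.
    rewrite -/(F _ _) -/(F _ _) -/X -/Y -E.
    by apply: complex_eqP; rewrite /la; coord; ring.
  rewrite raddfMn /= hornerMn => /eqP; rewrite mulrn_eq0 /= => rz.
  exact: rz.
- left=> z w z0 w0; have := H z w z0 w0; rewrite -sqmod_gt0 -/(F z w) => h.
  by have := sqmod_ge0 (F z (conjc w)); lra.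
- right=> z w z0 w0; have := H z w z0 w0; rewrite -sqmod_gt0 -/(F z _) => h.
  by have := sqmod_ge0 (F z w); lra.
Qed.

Lemma H2R_symbol n M (F : {poly {poly C}}) : real_operator n M ->
  (forall j, exists2 p : {poly R}, (size p <= n.+1)%N & F`_j = rpoly p) ->
  (forall z w, 0 < Im z -> 0 < Im w -> (M F.[w%:P]).[z] != 0) ->
  H2R (map_poly M F).
Proof.
move=> MR FR FN; split.
- apply: contraTneq (FN 'i%C 'i%C ltr01 ltr01) => F0.
  by rewrite -horner_map_linear F0 !horner0 eqxx.
- move=> i j; apply/NumIm_eq0; rewrite coef_map /=.
  by have [p sp ->] := FR i; apply: (realpolyP _).1 (MR p sp) j.
- by move=> z w; rewrite !NumIm_gt0 horner_map_linear; apply: FN.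
Qed.

Lemma coef_zpw_real n j :
  exists2 p : {poly R}, (size p <= n.+1)%N & (zpw R n)`_j = rpoly p.
Proof.
have [jn|jn] := leqP j n; last first.
  exists 0; rewrite ?size_poly0 // nth_default ?(leq_trans (size_zpw _ _)) //.
  by rewrite /rpoly rmorph0.
exists ('X^(n - j) *+ 'C(n, j)).
  by rewrite -scaler_nat (leq_trans (size_scale_leq _ _)) // size_polyXn ltnS leq_subr.
by rewrite coef_zpw // /rpoly rmorphMn /= -/(rpoly _) rpolyXn.
Qed.

Lemma coef_zmw_real n j :
  exists2 p : {poly R}, (size p <= n.+1)%N & (zmw R n)`_j = rpoly p.
Proof.
have [jn|jn] := leqP j n; last first.
  exists 0; rewrite ?size_poly0 // nth_default /rpoly ?rmorph0 //.
  rewrite (leq_trans _ jn) // /zmw (leq_trans (size_poly_exp_leq _ _)) //.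
  rewrite ltnS -[X in (_ <= X)%N]mul1n leq_mul2r -subn1 leq_subLR.
  rewrite (leq_trans (size_polyD _ _)) ?orbT // size_polyN size_polyX geq_max.
  by rewrite (leq_trans (size_polyC_leq1 _)) ?orbT.
exists ((-1) ^+ j * 'X^(n - j) *+ 'C(n, j)).
  rewrite -scaler_nat (leq_trans (size_scale_leq _ _)) //.
  by rewrite -signr_odd; case: odd; rewrite ?expr1 ?expr0 ?mulN1r ?mul1r
    ?size_polyN size_polyXn ltnS leq_subr.
rewrite coef_zmw // /rpoly rmorphMn rmorphM rmorphXn rmorphN1 /=.
by rewrite -/(rpoly _) rpolyXn.
Qed.

Lemma real_preserver_symbol n M : (0 < n)%N -> realrooted_preserver n M ->
  real_operator n M -> (forall p, simple_rooted n p -> M (rpoly p) != 0) ->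
  H2R (map_poly M (zpw R n)) \/ H2R (map_poly M (zmw R n)).
Proof.
move=> n0 MP MR inj; case: (symbol_sign n0 MP inj) => H; [left|right].
  apply: (H2R_symbol MR (@coef_zpw_real n)) => z w z0 w0.
  by rewrite horner_zpw H.
apply: (H2R_symbol MR (@coef_zmw_real n)) => z w z0 w0; rewrite horner_zmw.
(* The point [- conj w] again lies in the upper half-plane, and its conjugate is [- w]. *)
have w1 : 0 < Im (- conjc w) by rewrite ImN ImJ opprK.
have wE : conjc (- conjc w) = - w by apply: complex_eqP; coord; ring.
by have := H z _ z0 w1; rewrite wE polyCN.
Qed.

(** As [p0] is in the kernel, [M (p0 + e p) = e M p], and [p0 + e p] is real-rooted or zero for
    small [e > 0]. *)
Lemma degenerate_realrooted n M p0 : real_operator n M ->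
  realrooted_preserver n M -> simple_rooted n p0 -> M (rpoly p0) = 0 ->
  forall p, (size p <= n.+1)%N -> M (rpoly p) = 0 \/ piR (M (rpoly p)).
Proof.
move=> MR MP sr M0 p sp; have [d d0 Hd] := perturb_realrooted sr sp.
have h0 : 0 < d / 2 < d by apply/andP; split; lra.
have e0 : (d / 2)%:C != 0 :> C by rewrite fmorph_eq0 gt_eqF //; case/andP: h0.
have E : M (rpoly (p0 + d / 2 *: p)) = (d / 2)%:C *: M (rpoly p).
  by rewrite rpolyD rpolyZ linearD linearZ M0 add0r.
have sz0 : (size p0 <= n.+1)%N by case: sr => s [].
have szp : polyle n (rpoly (p0 + d / 2 *: p)).
  rewrite /polyle size_rpoly (leq_trans (size_polyD _ _)) // geq_max sz0.
  by rewrite (leq_trans (size_scale_leq _ _)).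
have : piR (M (rpoly (p0 + d / 2 *: p))) \/ M (rpoly (p0 + d / 2 *: p)) = 0.
  case: (Hd _ h0) => [->|H]; last exact: MP.
  by right; rewrite /rpoly rmorph0 linear0.
rewrite E => -[[N0 Nr]|/eqP]; last first.
  by rewrite scaler_eq0 (negPf e0) => /eqP; left.
right; split; first by move: N0; rewrite scaler_eq0 negb_or => /andP[].
by move=> z rz; apply: Nr; rewrite rootZ.
Qed.

End Necessity.

(** * Operators with range of dimension at most two *)

Section Classification.
Variable R : realType.
Local Notation C := R[i].
Local Notation Re := (@complex.Re R).
Local Notation Im := (@complex.Im R).
Implicit Types (x y z w : C) (f g : {poly C}) (p q : {poly R}).
Implicit Types (L M : {linear {poly C} -> {poly C}}).

Definition rank1_form n (T : {poly C} -> {poly C}) :=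
  exists (alpha : {poly C} -> C) P,
    [/\ linear_on n alpha, H1R P & forall f, polyle n f -> T f = alpha f *: P].

Definition rank2_form n (T : {poly C} -> {poly C}) :=
  exists (eta : C) (alpha beta : {poly C} -> C) P Q,
    [/\ linear_on n alpha, linear_on n beta,
        (forall f, polyle n f -> realpoly f ->
           Num.Theory.Im (alpha f) = 0 /\ Num.Theory.Im (beta f) = 0),
        [/\ H1R P, H1R Q & interlacing P Q] &
        forall f, polyle n f -> T f = (eta * alpha f) *: P + (eta * beta f) *: Q].

Lemma realrooted_i_neq0 f : piR f -> f.['i%C] != 0.
Proof.
move=> [_ /realrootedP fR]; apply/negP => /fR /eqP.
by rewrite Im_i oner_eq0.
Qed.

(** The value of [P] at [i] is not 0, so evaluation at [i] recovers the coefficient linearly. *)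
Lemma rank1_formI n L P : H1R P ->
  (forall f, polyle n f -> exists c, L f = c *: P) -> rank1_form n L.
Proof.
move=> HP H; have [P0 _ Pr] := HP.
have Pi : P.['i%C] != 0 by apply: realrooted_i_neq0.
exists (fun f => (L f).['i%C] / P.['i%C]), P; split=> //.
  by move=> a f g _ _; rewrite linearP !hornerE mulrDl -mulrA.
by move=> f /H [c ->]; rewrite hornerZ mulfK.
Qed.

Lemma polyle_ReIm n f : polyle n f ->
  (size (repoly f) <= n.+1)%N /\ (size (impoly f) <= n.+1)%N.
Proof.
by move=> sf; split; apply: leq_trans sf; rewrite ?size_repoly ?size_impoly.
Qed.

Lemma linear_ReIm L f :
  L f = L (rpoly (repoly f)) + 'i%C *: L (rpoly (impoly f)).
Proof. by rewrite {1}[f]poly_ReIm linearD linearZ. Qed.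

Lemma monomials_eq0 n L : (forall k, (k <= n)%N -> L 'X^k = 0) ->
  forall f, polyle n f -> L f = 0.
Proof.
move=> H f sf; rewrite -[f]coefK poly_def linear_sum big1 // => k _.
by rewrite linearZ /= H ?scaler0 // -ltnS (leq_trans (ltn_ord k)).
Qed.

Lemma cramer (m m' u u' v v' : C) : u * v' - u' * v != 0 ->
  m - ((m * v' - m' * v) / (u * v' - u' * v) * u
       + (u * m' - u' * m) / (u * v' - u' * v) * v) = 0.
Proof. by move=> D0; field. Qed.

Lemma opp_real z : Im z = 0 -> (- Re z)%:C = - z.
Proof. by move=> z0; apply: complex_eqP; coord; rewrite ?z0 ?oppr0. Qed.

(** A non-zero image of a real polynomial is real-rooted, hence non-zero at [i], and evaluation at
    [i] embeds these images in the plane. Either all values are real multiples of that of [P], or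
    [P] and a second image [Q] form a basis. *)
Lemma rank_le2 n M k p0 (eta : C) : real_operator n M ->
  (forall p, (size p <= n.+1)%N -> M (rpoly p) = 0 \/ piR (M (rpoly p))) ->
  (k <= n)%N -> M 'X^k = rpoly p0 -> piR (rpoly p0) ->
  (forall f, polyle n f -> exists c, M f = c *: rpoly p0) \/
  rank2_form n (eta \*: M).
Proof.
move=> MR MV kn Mk p0r; set P := rpoly p0 in Mk p0r *.
pose I : C := 'i%C.
pose X : {poly R} := 'X^k.
have szk : (size X <= n.+1)%N by rewrite size_polyXn ltnS.
have MXk : M (rpoly X) = P by rewrite -Mk; congr (M _); apply: rpolyXn.
have szD p q (a : R) : (size p <= n.+1)%N -> (size q <= n.+1)%N ->
    (size (p + a *: q)%R <= n.+1)%N.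
  move=> sp sq; rewrite (leq_trans (size_polyD _ _)) // geq_max sp.
  by rewrite (leq_trans (size_scale_leq _ _)).
have evalJ p : (size p <= n.+1)%N ->
    (M (rpoly p)).[conjc I] = conjc (M (rpoly p)).[I].
  by move=> sp; rewrite (realpolyE (MR p sp)) horner_rpolyJ.
have vanish p : (size p <= n.+1)%N -> (M (rpoly p)).[I] = 0 -> M (rpoly p) = 0.
  by move=> /MV [//|/realrooted_i_neq0 /eqP].
have Pi : P.[I] != 0 by apply: realrooted_i_neq0.
have [[q [sq D0]]|nq] := boolp.EM (exists q, (size q <= n.+1)%N /\
    Im (P.[I] * conjc (M (rpoly q)).[I]) != 0); last first.
  left=> f sf.
  have line p : (size p <= n.+1)%N -> exists c, M (rpoly p) = c *: P.
    move=> sp; set Q := M (rpoly p).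
    have D0 : Im (P.[I] * conjc Q.[I]) = 0.
      by apply/eqP/negPn/negP => D0; apply: nq; exists p.
    pose t := Re (Q.[I] * conjc P.[I]) / sqmod P.[I].
    have sP : sqmod P.[I] != 0 by rewrite sqmod_eq0.
    have Qt : Q.[I] = t%:C * P.[I].
      have PJ0 : conjc P.[I] != 0 by rewrite conjc_eq0.
      apply: (mulIf PJ0); rewrite -mulrA mulcJ -rmorphM divfK //.
      apply: complex_eqP; first by rewrite Re_real.
      by rewrite Im_real; move: D0; coord; lra.
    exists t%:C; apply/eqP; rewrite -subr_eq0; apply/eqP.
    have E : Q - t%:C *: P = M (rpoly (p + (- t) *: X)).
      by rewrite rpolyD rpolyZ linearD [in RHS]linearZ_LR MXk rmorphN scaleNr.
    rewrite E; apply: vanish; first exact: szD.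
    by rewrite -E !hornerE Qt subrr.
  have [s1 s2] := polyle_ReIm sf.
  have [c1 E1] := line _ s1; have [c2 E2] := line _ s2.
  by exists (c1 + 'i%C * c2); rewrite linear_ReIm E1 E2 scalerA -scalerDl.
right; set Q := M (rpoly q) in D0.
have qV : realpoly Q by apply: MR.
have QE : Q = rpoly (repoly Q) by apply: realpolyE.
pose D : C := P.[I] * conjc Q.[I] - conjc P.[I] * Q.[I].
have DE : D = (2 * Im (P.[I] * conjc Q.[I]))%:C * 'i%C.
  by apply: complex_eqP; rewrite /D; coord; ring.
have Dn0 : D != 0.
  rewrite DE mulf_neq0 ?fmorph_eq0 ?mulf_neq0 ?pnatr_eq0 //.
  by rewrite eq_complex /= oner_eq0 andbF.
(* Coordinates in the basis [P], [Q], by Cramer's rule on the values at [i] and [- i]. On real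
   polynomials these values are conjugate, so the numerators and [D] are purely imaginary and the
   quotients real. *)
pose al f := ((M f).[I] * conjc Q.[I] - (M f).[conjc I] * Q.[I]) / D.
pose be f := (P.[I] * (M f).[conjc I] - conjc P.[I] * (M f).[I]) / D.
have alR p : (size p <= n.+1)%N -> Im (al (rpoly p)) = 0 /\ Im (be (rpoly p)) = 0.
  move=> sp.
  have real (u v : C) : Im ((u * conjc v - conjc u * v) / D) = 0.
    have -> : u * conjc v - conjc u * v = (2 * Im (u * conjc v))%:C * 'i%C.
      by apply: complex_eqP; coord; ring.
    rewrite DE invfM mulrACA mulfV ?mulr1; last first.
      by rewrite eq_complex /= oner_eq0 andbF.
    by rewrite -fmorphV -rmorphM Im_real.
  by rewrite /al /be evalJ //; split; rewrite ?real // mulrC [X in _ - X]mulrC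
    [X in _ * X / _]mulrC real.
have lin (a : C) f g : al (a *: f + g) = a * al f + al g /\
                       be (a *: f + g) = a * be f + be g.
  have E1 (u v u' v' s t d : C) : ((a * u + v) * s - (a * u' + v') * t) / d =
      a * ((u * s - u' * t) / d) + (v * s - v' * t) / d by ring.
  have E2 (u v u' v' s t d : C) : (s * (a * u + v) - t * (a * u' + v')) / d =
      a * ((s * u - t * u') / d) + (s * v - t * v') / d by ring.
  by rewrite /al /be linearP !hornerD !hornerZ E1 E2.
have ME f : polyle n f -> M f = al f *: P + be f *: Q.
  have realcase p : (size p <= n.+1)%N ->
      M (rpoly p) = al (rpoly p) *: P + be (rpoly p) *: Q.
    move=> sp; have [a0 b0] := alR p sp.
    set a := al _ in a0 *; set b := be _ in b0 *.
    apply/eqP; rewrite -subr_eq0; apply/eqP.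
    (* The difference is the image of a real polynomial, so vanishing at [i] makes it 0. *)
    have E : M (rpoly p) - (a *: P + b *: Q)
        = M (rpoly (p + (- Re a) *: X + (- Re b) *: q)).
      have aE : (- Re a)%:C = - a by apply: opp_real.
      have bE : (- Re b)%:C = - b by apply: opp_real.
      rewrite !rpolyD !rpolyZ ![in RHS]linearD ![in RHS]linearZ_LR MXk -/Q aE bE.
      by rewrite !scaleNr opprD addrA.
    rewrite E; apply: vanish; first by rewrite szD ?szD.
    by rewrite -E !hornerE; apply: cramer.
  move=> sf; have [s1 s2] := polyle_ReIm sf.
  have fE : f = 'i%C *: rpoly (impoly f) + rpoly (repoly f).
    by rewrite addrC; apply: poly_ReIm.
  have [alE beE] := lin 'i%C (rpoly (impoly f)) (rpoly (repoly f)).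
  rewrite {1}fE linearP /= !realcase // [in RHS]fE alE beE !scalerDl !scalerDr.
  by rewrite !scalerA addrACA.
have PQ_comb (a b : R) : a *: p0 + b *: repoly Q = 0 -> a = 0 /\ b = 0.
  move=> E; have {}E : a%:C * P.[I] + b%:C * Q.[I] = 0.
    by rewrite QE -!hornerZ -hornerD -!rpolyZ -rpolyD E /rpoly rmorph0 horner0.
  have a0 : a = 0.
    have : a * Im (P.[I] * conjc Q.[I]) = 0.
      have -> : a * Im (P.[I] * conjc Q.[I])
          = Im ((a%:C * P.[I] + b%:C * Q.[I]) * conjc Q.[I]) by coord; ring.
      by rewrite E mul0r.
    by move/eqP; rewrite mulf_eq0 (negPf D0) orbF => /eqP.
  split=> //; move: E; rewrite a0 mul0r add0r => /eqP; rewrite mulf_eq0.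
  rewrite fmorph_eq0 => /orP[/eqP //|/eqP Q0].
  by case/eqP: D0; rewrite Q0 conjc0 mulr0.
have PQ_pencil (a b : R) : a *: p0 + b *: repoly Q = 0 \/
    piR (rpoly (a *: p0 + b *: repoly Q)).
  have E : rpoly (a *: p0 + b *: repoly Q) = M (rpoly (a *: X + b *: q)).
    by rewrite !rpolyD !rpolyZ linearD !linearZ_LR MXk -QE.
  have [|h|h] := MV (a *: X + b *: q).
  - by rewrite szD // (leq_trans (size_scale_leq _ _)).
  - by left; apply/eqP; rewrite -rpoly_eq0 E h.
  - by right; rewrite E.
have Q1 : piR Q.
  have [Q0|//] := MV q sq; case/eqP: D0.
  by rewrite /Q Q0 horner0 conjc0 mulr0.
exists eta, al, be, P, Q; split.
- by move=> a f g _ _; have [] := lin a f g.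
- by move=> a f g _ _; have [] := lin a f g.
- move=> f sf fR; have [s1 _] := polyle_ReIm sf.
  by rewrite (realpolyE fR); have [h1 h2] := alR _ s1; split; apply/NumIm_eq0.
- split; [by case: p0r; split=> //; apply: realpoly_rpoly|by case: Q1; split|].
  by rewrite QE; apply: interlacing_of_pencil.
- by move=> f sf; rewrite /= ME // scalerDr !scalerA.
Qed.

End Classification.

(** * Assembling the classification *)

Section Assembly.
Variable R : realType.
Local Notation C := R[i].
Implicit Types (z w : C) (f g : {poly C}) (p q : {poly R}).
Implicit Types (L M : {linear {poly C} -> {poly C}}).

Lemma piR_Xn k : piR ('X^k : {poly C}).
Proof.
split; first by rewrite -size_poly_eq0 size_polyXn.
apply/realrootedP => z; rewrite /root hornerXn expf_eq0 => /andP[_ /eqP ->].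
by [].
Qed.

Lemma symbol_scale L M (eta : C) (F : {poly {poly C}}) :
  (forall f, M f = eta *: L f) -> eta%:P *: map_poly L F = map_poly M F.
Proof.
by move=> ML; apply/polyP => j; rewrite coefZ !coef_map /= ML mul_polyC.
Qed.

Lemma preserver_classification n L : realrooted_preserver n L ->
  [\/ rank1_form n L, rank2_form n L,
      exists eta : C, H2R (eta%:P *: map_poly L (zpw R n)) |
      exists eta : C, H2R (eta%:P *: map_poly L (zmw R n))].
Proof.
move=> LP.
have [[k [kn Lk]]|nk] := boolp.EM (exists k, (k <= n)%N /\ L 'X^k != 0); last first.
  apply: Or41; apply: (@rank1_formI _ _ _ (rpoly 1)).
    split; [by rewrite rpoly_eq0 oner_eq0|exact: realpoly_rpoly|].
    by move=> z; rewrite /rpoly rmorph1 (negPf (root1 _)).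
  move=> f sf; exists 0; rewrite scale0r; apply: monomials_eq0 sf => k kn.
  by apply/eqP/negPn/negP => Lk; apply: nk; exists k.
have Lr : realrooted (L 'X^k).
  have [||[]//|/eqP] := LP 'X^k; first by rewrite /polyle size_polyXn ltnS.
    exact: piR_Xn.
  by rewrite (negPf Lk).
have [s Es] := realrooted_factor Lk Lr.
set c := lead_coef _ in Es; have c0 : c != 0 by rewrite lead_coef_eq0.
set p0 := \prod_(x <- s) _ in Es.
have p00 : p0 != 0 by rewrite monic_neq0 // monic_prod_XsubC.
have p0r : piR (rpoly p0).
  split; first by rewrite rpoly_eq0.
  by move=> z rz; apply: Lr; rewrite Es rootZ.
have HP : H1R (rpoly p0) by case: p0r; split=> //; apply: realpoly_rpoly.
(* Dividing by [c] makes the image of ['X^k] real; [c] is handed to [rank_le2] for (b), and its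
   inverse serves as [eta] in (c) and (d). *)
pose M : {linear {poly C} -> {poly C}} := c^-1 \*: L.
have ME f : M f = c^-1 *: L f by [].
have LE f : L f = c *: M f by rewrite ME scalerA mulfV // scale1r.
have Mk : M 'X^k = rpoly p0 by rewrite ME Es scalerA mulVf // scale1r.
have MP : realrooted_preserver n M.
  move=> f sf /(LP f sf) [[Lf0 Lfr]|Lf0]; last by right; rewrite ME Lf0 scaler0.
  left; rewrite ME; split; first by rewrite scaler_eq0 invr_eq0 (negPf c0).
  by move=> z; rewrite rootZ ?invr_eq0 //; apply: Lfr.
have line : (forall f, polyle n f -> exists a, M f = a *: rpoly p0) ->
    rank1_form n L.
  move=> H; apply: (rank1_formI HP) => f /H [a Ma].
  by exists (c * a); rewrite LE Ma scalerA.
case: (posnP n) => [n0|n0].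
  apply: Or41; apply: line => f; rewrite /polyle n0 => sf.
  have k0 : k = 0%N by apply/eqP; rewrite -leqn0 -n0.
  exists f`_0; rewrite -Mk k0 expr0 {1}(size1_polyC sf) -alg_polyC.
  by rewrite linearZ_LR.
case: (rank1_or_real n0 MP kn Mk p00) => [H|MR].
  apply: Or41; apply: line => f sf; have [s1 s2] := polyle_ReIm sf.
  have [c1 E1] := H _ s1; have [c2 E2] := H _ s2.
  by exists (c1 + 'i%C * c2); rewrite linear_ReIm E1 E2 scalerA -scalerDl.
(* A simple-rooted polynomial in the kernel makes all images of real polynomials real-rooted or
   zero, which leads to (a) or (b); without one, a symbol is stable. *)
have [[q [qs Mq]]|nq] :=
  boolp.EM (exists q, simple_rooted n q /\ M (rpoly q) = 0).
  have V := degenerate_realrooted MR MP qs Mq.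
  case: (rank_le2 c MR V kn Mk p0r) => [H|[eta [al [be [P [Q [h1 h2 h3 h4 h5]]]]]]].
    by apply: Or41; apply: line.
  apply: Or42; exists eta, al, be, P, Q; split=> // f sf.
  by rewrite LE -h5.
have inj q : simple_rooted n q -> M (rpoly q) != 0.
  by move=> qs; apply/eqP => Mq; apply: nq; exists q.
case: (real_preserver_symbol n0 MP MR inj) => H.
  by apply: Or43; exists c^-1; rewrite (symbol_scale _ ME).
by apply: Or44; exists c^-1; rewrite (symbol_scale _ ME).
Qed.

(** [T] is known to be linear only in degree at most [n]; truncating the argument first gives a map
    linear everywhere with the same values there. *)
Lemma linear_on_truncate n (T : {poly C} -> {poly C}) : linear_on n T ->
  exists L : {linear {poly C} -> {poly C}}, forall f, polyle n f -> T f = L f.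
Proof.
move=> hT; pose l f := T (take_poly n.+1 f).
have lin : linear l.
  move=> a f g; rewrite /l take_polyD take_polyZ.
  by apply: hT; apply: size_take_poly.
pose LM := GRing.isLinear.Build _ _ _ _ l lin.
pose L : {linear {poly C} -> {poly C}} := HB.pack l LM.
by exists L => f sf; rewrite /= /l take_poly_id.
Qed.

Lemma map_poly_eq_coef (T U : {poly C} -> {poly C}) (F : {poly {poly C}}) :
  (forall j, T F`_j = U F`_j) -> map_poly T F = map_poly U F.
Proof.
by move=> H; rewrite /map_poly; apply: eq_poly => j _.
Qed.

End Assembly.

Theorem mainTheorem2 (R : realType) (n : nat) (T : {poly R[i]} -> {poly R[i]})
  (hT : linear_on n T) :
  (forall f : {poly R[i]}, polyle n f -> piR f -> piR (T f) \/ T f = 0)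
  <->
  [\/ (* (a) *)
      (exists (alpha : {poly R[i]} -> R[i]) (P : {poly R[i]}),
         [/\ linear_on n alpha, H1R P &
             forall f, polyle n f -> T f = alpha f *: P]),
      (* (b) *)
      (exists (eta : R[i]) (alpha beta : {poly R[i]} -> R[i]) (P Q : {poly R[i]}),
         [/\ linear_on n alpha, linear_on n beta,
             (forall f, polyle n f -> realpoly f ->
                Im (alpha f) = 0 /\ Im (beta f) = 0),
             [/\ H1R P, H1R Q & interlacing P Q] &
             forall f, polyle n f ->
               T f = (eta * alpha f) *: P + (eta * beta f) *: Q]),
      (* (c) *)
      (exists eta : R[i], H2R (eta%:P *: Text T (zpw R n))) |
      (* (d) *)
      (exists eta : R[i], H2R (eta%:P *: Text T (zmw R n)))].
Proof.
have [L TL] := linear_on_truncate hT.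
(* The coefficients of both symbols have degree at most [n] in [z], so [T] and [L] give the same
   images of them. *)
have Tp : Text T (zpw R n) = map_poly L (zpw R n).
  apply: map_poly_eq_coef => j; apply: TL.
  by have [p sp ->] := coef_zpw_real R n j; rewrite /polyle size_rpoly.
have Tm : Text T (zmw R n) = map_poly L (zmw R n).
  apply: map_poly_eq_coef => j; apply: TL.
  by have [p sp ->] := coef_zmw_real R n j; rewrite /polyle size_rpoly.
rewrite Tp Tm; split.
  move=> TP; have LP : realrooted_preserver n L.
    by move=> f sf fr; rewrite -TL //; apply: TP.
  case: (preserver_classification LP) => [[al [P [h1 h2 h3]]]|H|H|H].
  - by apply: Or41; exists al, P; split=> // f sf; rewrite TL // h3.
  - case: H => eta [al [be [P [Q [h1 h2 h3 h4 h5]]]]].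
    by apply: Or42; exists eta, al, be, P, Q; split=> // f sf; rewrite TL // h5.
  - exact: Or43.
  - exact: Or44.
case=> [[al [P [_ [P0 _ Pr] TE]]] f sf _
  |[eta [al [be [P [Q [la lb lR [[P0 PR Pr] [Q0 QR Qr] I] TE]]]]]] f sf [f0 fr]
  |[eta H] f sf fr|[eta H] f sf fr].
- rewrite TE //; have [->|a0] := eqVneq (al f) 0; first by right; rewrite scale0r.
  by left; split; [rewrite scaler_eq0 negb_or a0|move=> z; rewrite rootZ //; apply: Pr].
(* Up to a constant [c] the input is a real polynomial [g], on which [al] and [be] are real; so
   [T f] is a constant times a real combination of [P] and [Q]. *)
- have [s Es] := realrooted_factor f0 fr; set c := lead_coef f in Es.
  set g := rpoly _ in Es.
  have c0 : c != 0 by rewrite lead_coef_eq0.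
  have sg : polyle n g by move: sf; rewrite /polyle {1}Es size_scale.
  have s0 : polyle n (0 : {poly R[i]}) by rewrite /polyle size_poly0.
  have scal (l : {poly R[i]} -> R[i]) : linear_on n l -> l (c *: g) = c * l g.
    (* The scalar [-1] applied to zero polynomials yields [l 0 = 0]. *)
    move=> hl; have := hl (-1) 0 0 s0 s0.
    rewrite scaler0 addr0 scaleN1r addNr => l0.
    by have := hl c g 0 sg s0; rewrite l0 !addr0.
  have [/NumIm_eq0 a0 /NumIm_eq0 b0] := lR g sg (realpoly_rpoly _).
  have E : T f = (eta * c) *: (al g *: P + be g *: Q).
    by rewrite TE // Es !scal // scalerDr !scalerA !mulrA.
  have [k0|k0] := eqVneq (eta * c) 0; first by right; rewrite E k0 scale0r.
  case: (interlacing_pencil PR QR I a0 b0) => [h|[h1 h2]].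
    by right; rewrite E h scaler0.
  left; rewrite E; split; first by rewrite scaler_eq0 negb_or k0.
  by move=> z; rewrite rootZ //; apply: h2.
- by rewrite TL //; apply: preserver_of_zpw H _ sf fr.
- by rewrite TL //; apply: preserver_of_zmw H _ sf fr.
Qed.
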